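(* Let $D$ be a connected locally-finite digraph with more than one end, and suppose that $D$ embeds a triangle. Then $D$ is connected-homogeneous if and only if it is isomorphic to $T(r)$ for some $r\in\mathbb{N}$.
   Context: A digraph is a set with an irreflexive antisymmetric arc relation $\to$; connectivity and ends refer to the underlying undirected graph (ends of a connected locally-finite graph are equivalence classes of rays, two rays being equivalent if some third ray meets each infinitely often). ''Embeds a triangle'' means the underlying undirected graph has three mutually adjacent vertices. Locally-finite: finite in- and out-degrees. Connected-homogeneous: every isomorphism between finite connected induced subdigraphs extends to an automorphism. $T(r)$ is the directed Cayley graph of the free product $\langle a_1\rangle*\cdots*\langle a_r\rangle$ with $a_i^3=1$, with respect to the generating set $\{a_1,\dots,a_r\}$, i.e. vertices are group elements and arcs are $g\to ga_i$. *)

(* Defs.v *)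
From Stdlib Require Import List.
From mathcomp Require Import all_boot.
Set Implicit Arguments. Unset Strict Implicit. Unset Printing Implicit Defensive.

Definition is_digraph (V : Type) (arc : V -> V -> Prop) : Prop :=
  (forall x, ~ arc x x) /\ (forall x y, arc x y -> ~ arc y x).

Definition adj (V : Type) (arc : V -> V -> Prop) (x y : V) : Prop :=
  arc x y \/ arc y x.

Definition finite_set (V : Type) (A : V -> Prop) : Prop :=
  exists l : list V, forall x, A x -> List.In x l.

Definition locally_finite (V : Type) (arc : V -> V -> Prop) : Prop :=
  forall x, finite_set (fun y => arc x y) /\ finite_set (fun y => arc y x).

Inductive upath (V : Type) (arc : V -> V -> Prop) (A : V -> Prop) : V -> V -> Prop :=
  | upath_refl x : A x -> upath arc A x x
  | upath_step x y z : A x -> adj arc x y -> upath arc A y z -> upath arc A x z.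

Definition connected_in (V : Type) (arc : V -> V -> Prop) (A : V -> Prop) : Prop :=
  forall x y, A x -> A y -> upath arc A x y.

Definition connected (V : Type) (arc : V -> V -> Prop) : Prop :=
  connected_in arc (fun _ => True).

Definition is_ray (V : Type) (arc : V -> V -> Prop) (R : nat -> V) : Prop :=
  (forall n m, R n = R m -> n = m) /\ (forall n, adj arc (R n) (R n.+1)).

Definition meets_inf (V : Type) (R S : nat -> V) : Prop :=
  forall N, exists n, N <= n /\ exists m, R n = S m.

Definition equiv_rays (V : Type) (arc : V -> V -> Prop) (R1 R2 : nat -> V) : Prop :=
  exists R3, is_ray arc R3 /\ meets_inf R3 R1 /\ meets_inf R3 R2.

Definition more_than_one_end (V : Type) (arc : V -> V -> Prop) : Prop :=
  exists R1 R2, is_ray arc R1 /\ is_ray arc R2 /\ ~ equiv_rays arc R1 R2.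

Definition embeds_triangle (V : Type) (arc : V -> V -> Prop) : Prop :=
  exists x y z, adj arc x y /\ adj arc y z /\ adj arc x z.

Definition automorphism (V : Type) (arc : V -> V -> Prop) (g : V -> V) : Prop :=
  bijective g /\ (forall x y, arc x y <-> arc (g x) (g y)).

Definition conn_homogeneous (V : Type) (arc : V -> V -> Prop) : Prop :=
  forall (A B : V -> Prop) (f : V -> V),
    finite_set A -> connected_in arc A ->
    (forall x, A x -> B (f x)) ->
    (forall x y, A x -> A y -> f x = f y -> x = y) ->
    (forall y, B y -> exists x, A x /\ f x = y) ->
    (forall x y, A x -> A y -> (arc x y <-> arc (f x) (f y))) ->
    exists g, automorphism arc g /\ (forall x, A x -> g x = f x).

(** * T(r): Cayley digraph of <a_1> * ... * <a_r>, a_i^3 = 1, generators a_i *)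

(* Elements of the free product are reduced words; we store a word
   REVERSED (head = last letter).  A letter (i, true) is a_i, (i, false) is
   a_i^2.  Reduced: consecutive letters have distinct indices. *)
Definition letter (r : nat) := ('I_r * bool)%type.

Definition reduced (r : nat) (w : seq (letter r)) : bool :=
  sorted (fun a b : letter r => a.1 != b.1) w.

(* Right multiplication by the generator a_i on a (reversed) reduced word. *)
Definition mul_gen (r : nat) (i : 'I_r) (w : seq (letter r)) : seq (letter r) :=
  match w with
  | (j, b) :: w' =>
      if j == i then (if b then (i, false) :: w' else w') else (i, true) :: w
  | [::] => [:: (i, true)]
  end.

Definition Tvert (r : nat) := {w : seq (letter r) | reduced w}.

Definition Tarc (r : nat) (u v : Tvert r) : Prop :=
  exists i : 'I_r, val v = mul_gen i (val u).

Definition isomorphic_to_T (V : Type) (arc : V -> V -> Prop) (r : nat) : Prop :=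
  exists phi : V -> Tvert r,
    bijective phi /\ (forall x y, arc x y <-> Tarc (phi x) (phi y)).

(* Main.v *)
Require Import Defs.
From Stdlib Require Import List.
From mathcomp Require Import all_boot perm.
From mathcomp Require Import boolp zify.
Set Implicit Arguments. Unset Strict Implicit. Unset Printing Implicit Defensive.

(** By Dunwoody's argument, the edge cuts of minimal size between infinite sets that
    cross as few such cuts as possible are pairwise nested; they form an
    Aut(D)-invariant family whose members are the edges of a structure tree, in
    which adjacent vertices of D all have the same distance t > 0 by
    arc-transitivity.  Hence two neighbours of x have Gromov product exactly t/2
    at x when they are adjacent, and, by homogeneity and since there are
    triangles, less than t/2 when they are not.  So every neighbourhood is a
    disjoint union of cliques, and walks turning from one clique to another never
    return.  A parity count in the cliques, which are homogeneous tournaments,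
    excludes transitive triangles, so every arc lies in exactly one triangle and
    this triangle is cyclic; the words over the generators of T(r) then
    coordinatise D.

    Conversely, a partial isomorphism of T(r) is extended vertex by vertex, by
    left translations and by swaps of two branches at a vertex. *)

(** * Cardinals of finite predicates *)

(** The structure tree is never built. Its distances and Gromov products are numbers of optimal
    cuts, so what is needed of these cuts is that they are nested, invariant, connected, and
    finitely many across each edge. The value t/2 comes from a linear system: along each edge of a
    triangle the Gromov products at the two ends add up to t, which forces all three to be equal.
    Reaching the threshold t/2 is a transitive relation by the ultrametric inequality. If two
    non-adjacent neighbours reached it, homogeneity would put all neighbours of a vertex into one
    branch, and a smallest cut there would isolate the vertex. Homogeneity is used only for single
    vertices and for a vertex with two neighbours; what the tree contributes to the coordinates is
    just a parent relation pointing back to a base vertex. *)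

Section FiniteCardinal.
Variable T : eqType.
Implicit Types P Q R : T -> Prop.

Definition fin P := exists L : seq T, forall z, P z -> z \in L.

Definition lists P (L : seq T) := uniq L /\ forall z, P z <-> z \in L.

Lemma finE P : fin P -> exists L, lists P L.
Proof.
move=> [L PL]; exists (undup (filter (fun z => `[< P z >]) L)); split.
  exact: undup_uniq.
move=> z; rewrite mem_undup mem_filter; split.
  by move=> Pz; rewrite PL // andbT; exact/asboolP.
by case/andP => /asboolP.
Qed.

Definition ncard P : nat :=
  if pselect (exists L, lists P L) is left h then size (projT1 (cid h)) else 0.

Lemma ncardE P L : lists P L -> ncard P = size L.
Proof.
move=> [uL PL]; rewrite /ncard; case: pselect => [h|]; last by case; exists L.
case: (cid h) => L' [uL' PL'] /=; apply/eqP; rewrite eqn_leq.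
by rewrite !uniq_leq_size // => z; rewrite -PL -PL'.
Qed.

Lemma fin_sub P Q : fin Q -> (forall z, P z -> Q z) -> fin P.
Proof. by move=> [L QL] PQ; exists L => z /PQ/QL. Qed.

Lemma finU P Q : fin P -> fin Q -> fin (fun z => P z \/ Q z).
Proof.
move=> [L PL] [M QM]; exists (L ++ M) => z; rewrite mem_cat.
by case=> [/PL|/QM] ->; rewrite ?orbT.
Qed.

Lemma eq_ncard P Q : (forall z, P z <-> Q z) -> ncard P = ncard Q.
Proof. by move=> PQ; congr ncard; apply/predeqP. Qed.

Lemma ncard_le P Q : fin Q -> (forall z, P z -> Q z) -> ncard P <= ncard Q.
Proof.
move=> fQ PQ; have [M lM] := finE fQ; have [L lL] := finE (fin_sub fQ PQ).
rewrite (ncardE lM) (ncardE lL); apply: uniq_leq_size; first by case: lL.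
by move=> z; case: lL => _ <-; case: lM => _ <- /PQ.
Qed.

Lemma ncard0 P : (forall z, ~ P z) -> ncard P = 0.
Proof. by move=> P0; apply: (@ncardE _ [::]); split => // z; split => // /P0. Qed.

Lemma ncard_gt0 P z : fin P -> P z -> 0 < ncard P.
Proof.
move=> fP Pz; have [L lL] := finE fP; rewrite (ncardE lL).
by case: lL => _ PL; move/PL: Pz; case: L {PL}.
Qed.

Lemma ncard_ex P : 0 < ncard P -> exists z, P z.
Proof.
move=> P0; apply: contrapT => nP; move: P0; rewrite ncard0 // => z Pz.
by apply: nP; exists z.
Qed.

Lemma ncard_split P R : fin P ->
  ncard P = ncard (fun z => P z /\ R z) + ncard (fun z => P z /\ ~ R z).
Proof.
move=> fP; have [L [uL PL]] := finE fP; rewrite (@ncardE _ L) //.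
rewrite (@ncardE _ (filter (fun z => `[< R z >]) L)); last first.
  split=> [|z]; first exact: filter_uniq.
  rewrite mem_filter; split.
    by case=> /PL -> Rz; rewrite andbT; exact/asboolP.
  by case/andP => /asboolP Rz /PL.
rewrite (@ncardE _ (filter (fun z => ~~ `[< R z >]) L)); last first.
  split=> [|z]; first exact: filter_uniq.
  rewrite mem_filter; split.
    by case=> /PL -> Rz; rewrite andbT; exact/asboolPn.
  by case/andP => /asboolPn Rz /PL.
by rewrite !size_filter count_predC.
Qed.

Lemma ncardUI P Q : fin P -> fin Q ->
  ncard P + ncard Q = ncard (fun z => P z \/ Q z) + ncard (fun z => P z /\ Q z).
Proof.
move=> fP fQ; rewrite (ncard_split Q fP) (ncard_split P (finU fP fQ)).
rewrite (_ : ncard (fun z => (P z \/ Q z) /\ P z) = ncard P); last first.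
  by apply: eq_ncard => z; tauto.
rewrite (ncard_split Q fP) (ncard_split P fQ).
rewrite (_ : ncard (fun z => Q z /\ P z) = ncard (fun z => P z /\ Q z)); last first.
  by apply: eq_ncard => z; tauto.
rewrite (_ : ncard (fun z => (P z \/ Q z) /\ ~ P z) = ncard (fun z => Q z /\ ~ P z)).
  by lia.
by apply: eq_ncard => z; tauto.
Qed.

Lemma ncard_lt P Q z : fin Q -> (forall z, P z -> Q z) -> Q z -> ~ P z ->
  ncard P < ncard Q.
Proof.
move=> fQ PQ Qz nPz; rewrite (ncard_split P fQ).
rewrite (_ : ncard (fun z => Q z /\ P z) = ncard P); last first.
  by apply: eq_ncard => y; split; [tauto | move=> Py; split => //; apply: PQ].
have : 0 < ncard (fun z => Q z /\ ~ P z); last lia.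
by apply: (ncard_gt0 (z := z)) => //; apply: fin_sub fQ _ => y [].
Qed.

(** Abstract submodularity: applied to the boundaries of two cuts and of their corners. The strict
    form below, for the cuts crossing them, gains from an element that both corners miss. *)
Lemma ncard_submod P Q P' Q' : fin P -> fin Q ->
  (forall z, P' z -> P z \/ Q z) -> (forall z, Q' z -> P z \/ Q z) ->
  (forall z, P' z -> Q' z -> P z /\ Q z) ->
  ncard P' + ncard Q' <= ncard P + ncard Q.
Proof.
move=> fP fQ P'P Q'P PQ; have fU := finU fP fQ.
rewrite (ncardUI fP fQ) (ncardUI (fin_sub fU P'P) (fin_sub fU Q'P)).
apply: leq_add; apply: ncard_le => //.
- by move=> z [/P'P|/Q'P].
- by apply: fin_sub fP _ => z [].
- by move=> z []; apply: PQ.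
Qed.

Lemma ncard_submod_lt P Q P' Q' z0 : fin P -> fin Q ->
  (forall z, P' z -> P z \/ Q z) -> (forall z, Q' z -> P z \/ Q z) ->
  (forall z, P' z -> Q' z -> P z /\ Q z) -> P z0 \/ Q z0 -> ~ P' z0 -> ~ Q' z0 ->
  ncard P' + ncard Q' < ncard P + ncard Q.
Proof.
move=> fP fQ P'P Q'P PQ PQ0 nP' nQ'; have fU := finU fP fQ.
rewrite (ncardUI fP fQ) (ncardUI (fin_sub fU P'P) (fin_sub fU Q'P)).
rewrite -addSn; apply: leq_add.
  by apply: (ncard_lt (z := z0)) => //; [move=> z [/P'P|/Q'P] | case].
apply: ncard_le; first by apply: fin_sub fP _ => z [].
by move=> z []; apply: PQ.
Qed.

End FiniteCardinal.

Lemma fin_map (T U : eqType) (P : T -> Prop) (Q : U -> Prop) (f : T -> U) :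
  fin P -> (forall z, Q z -> exists2 y, P y & f y = z) -> fin Q.
Proof.
move=> [L PL] QP; exists (map f L) => z /QP [y /PL yL <-]; exact: map_f.
Qed.

Lemma fin_bigU (T U : eqType) (s : seq T) (P : T -> U -> Prop) :
  (forall x, x \in s -> fin (P x)) -> fin (fun z => exists2 x, x \in s & P x z).
Proof.
elim: s => [|a s IHs] h; first by exists [::] => z [].
have fU := finU (h a (mem_head _ _)) (IHs (fun q qs => h q (@mem_behead _ (a :: s) q qs))).
apply: fin_sub fU _ => z [x]; rewrite inE => /orP[/eqP->|xs] Px; first by left.
by right; exists x.
Qed.

Lemma ncard_bij (T U : eqType) (P : T -> Prop) (Q : U -> Prop)
    (f : T -> U) (g : U -> T) :
  (forall z, P z -> Q (f z)) -> (forall z, Q z -> P (g z)) ->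
  cancel f g -> cancel g f -> fin P -> ncard P = ncard Q.
Proof.
move=> PQ QP fK gK fP; have [L [uL PL]] := finE fP.
rewrite (@ncardE _ P L) // (@ncardE _ Q (map f L)) ?size_map //; split.
  by rewrite map_inj_uniq //; exact: can_inj fK.
move=> z; split; first by move/QP/PL/(map_f f); rewrite gK.
by case/mapP => y /PL/PQ Qy ->.
Qed.

Lemma min_nat (P : nat -> Prop) : (exists n, P n) ->
  exists n, P n /\ forall m, P m -> n <= m.
Proof.
move=> [n Pn]; have ex : exists n, `[< P n >] by exists n; apply/asboolP.
case: (ex_minnP ex) => m /asboolP Pm mmin; exists m; split => // k Pk.
by apply: mmin; apply/asboolP.
Qed.

(** * Tight edge cuts *)

(** Connectedness as an induction principle, which spares the handling of paths; the empty set
    counts as connected. *)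
Definition conn (V : Type) (e : rel V) (C : V -> bool) : Prop :=
  forall (A : V -> Prop) x, C x -> A x ->
    (forall u v, C u -> C v -> e u v -> A u -> A v) -> forall y, C y -> A y.

Definition compl (V : Type) (C : V -> bool) : V -> bool := fun x => ~~ C x.

Lemma complK (V : Type) : involutive (@compl V).
Proof. by move=> C; apply: funext => x; rewrite /compl negbK. Qed.

Section TightCuts.
Variable V : eqType.
Implicit Types (e : rel V) (C D : V -> bool).

(** For symmetric [e] each cut edge occurs in both orientations. Sizes double, minimality is
    unaffected, and a set and its complement have the same boundary. *)
Definition bnd e C : V * V -> Prop := fun p => e p.1 p.2 /\ C p.1 != C p.2.

(* Every set separating [x] from [y] cuts one of the edges of a fixed path. *)
Definition linking e (x y : V) (E : seq (V * V)) : Prop :=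
  (forall p, p \in E -> e p.1 p.2) /\
  forall C, C x -> ~~ C y -> exists2 p, p \in E & C p.1 && ~~ C p.2.

Definition linked e (x y : V) : Prop := exists E, linking e x y E.

Lemma linked_refl e x : linked e x x.
Proof. by exists [::]; split => // C ->. Qed.

Lemma linked_step e x y z : linked e x y -> e y z -> linked e x z.
Proof.
move=> [E [eE sE]] yz; exists ((y, z) :: E); split.
  by move=> p; rewrite inE => /orP[/eqP->|/eE].
move=> C Cx Cz; case Cy: (C y).
  by exists (y, z); rewrite ?inE ?eqxx //= Cy.
have [p pE Cp] := sE C Cx (negbT Cy).
by exists p => //; rewrite inE pE orbT.
Qed.

Lemma conn_linked e x y : conn e xpredT -> linked e x y.
Proof.
move=> ce; apply: (ce _ x isT) => //; first exact: linked_refl.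
by move=> u v _ _ uv /linked_step; exact.
Qed.

(* Induction on the size of the boundary: after deleting the edge [x y], either
   a path still joins its ends, and the set cuts one of its edges with a smaller
   boundary, or the set is the component of [x]. *)
Lemma tight_fin n e x y : symmetric e -> e x y ->
  fin (fun C => [/\ conn e C, conn e (compl C), C x, ~~ C y &
                 fin (bnd e C) /\ ncard (bnd e C) <= n]).
Proof.
elim: n e x y => [|n IHn] e x y e_sym xy.
  exists [::] => C [_ _ Cx Cy [fC]]; rewrite leqNgt => /negP[].
  by apply: (ncard_gt0 (z := (x, y))) => //; split => //=; rewrite Cx (negbTE Cy).
pose e' u v := [&& e u v, (u, v) != (x, y) & (v, u) != (x, y)].
have e'sym : symmetric e' by move=> u v; rewrite /e' e_sym; congr andb; exact: andbC.
have e'conn C : C x -> ~~ C y -> conn e C -> conn e' C.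
  move=> Cx Cy cC A u0 Cu0 Au0 cl; apply: (cC A u0) => // u v Cu Cv uv.
  apply: cl => //; rewrite /e' uv !xpair_eqE /=; apply/andP; split.
    by apply/negP => /andP[_ /eqP h]; rewrite -h Cv in Cy.
  by apply/negP => /andP[_ /eqP h]; rewrite -h Cu in Cy.
have e'bnd C : C x -> ~~ C y -> fin (bnd e C) -> ncard (bnd e C) <= n.+1 ->
    fin (bnd e' C) /\ ncard (bnd e' C) <= n.
  move=> Cx Cy fC Cn; have sub z : bnd e' C z -> bnd e C z by case=> /and3P[].
  split; first exact: fin_sub fC sub.
  rewrite -ltnS; apply: leq_trans Cn; apply: (ncard_lt (z := (x, y))) => //.
    by split => //=; rewrite Cx (negbTE Cy).
  by case; rewrite /e' eqxx andbF.
case: (lem (linked e' x y)) => [[E [eE sE]]|nxy].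
  have fE : fin (fun C => exists2 p, p \in E &
      [/\ conn e' C, conn e' (compl C), C p.1, ~~ C p.2 &
          fin (bnd e' C) /\ ncard (bnd e' C) <= n]).
    by apply: fin_bigU => p /eE; exact: IHn.
  apply: fin_sub fE _ => C [cC cC' Cx Cy [fC Cn]].
  have [p pE /andP[Cp Cp']] := sE C Cx Cy; exists p => //; split=> //.
  - exact: e'conn.
  - move: cC'; rewrite /compl => cC' A u0 Cu0 Au0 cl.
    apply: (cC' A u0) => // u v Cu Cv uv.
    apply: cl => //; rewrite /e' uv !xpair_eqE /=; apply/andP; split.
      by apply/negP => /andP[/eqP h _]; rewrite -h (negbTE Cu) in Cx.
    by apply/negP => /andP[/eqP h _]; rewrite -h (negbTE Cv) in Cx.
  - exact: e'bnd.
exists [:: fun z => `[< linked e' x z >]] => C [cC cC' Cx Cy [fC Cn]].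
rewrite inE; apply/eqP/funext => z; apply/idP/idP.
  move=> Cz; apply/asboolP; apply: (e'conn C Cx Cy cC _ x) => //; first exact: linked_refl.
  by move=> u v _ _ uv /linked_step; apply.
move=> /asboolP xz; apply/negPn/negP => Cz.
have : ~ linked e' x z; last by [].
apply: (cC' (fun z => ~ linked e' x z) y) => // u v Cu Cv uv nu xv; apply: nu.
apply: linked_step xv _; rewrite e'sym /e' uv !xpair_eqE /=; apply/andP; split.
  by apply/negP => /andP[/eqP h _]; move: Cu; rewrite /compl h Cx.
by apply/negP => /andP[/eqP h _]; move: Cv; rewrite /compl h Cx.
Qed.

End TightCuts.

(** * A nested invariant family of cuts *)

(** Each case says that one of the four corners of [C] and [D] is empty. *)
Definition nested (V : Type) (C D : V -> bool) : Prop :=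
  [\/ forall x, C x -> D x, forall x, D x -> C x,
      forall x, C x -> ~~ D x | forall x, ~~ C x -> D x].

Lemma nestedC (V : Type) (C D : V -> bool) : nested C D -> nested D C.
Proof.
case=> h; [exact: Or42 | exact: Or41 | apply: Or43 | apply: Or44] => x.
  by apply: contraL => /h.
by apply: contraR => /h.
Qed.

Lemma nested_complr (V : Type) (C D : V -> bool) :
  nested C (compl D) <-> nested C D.
Proof.
rewrite /compl; split; case=> h.
- exact: Or43.
- by apply: Or44 => x; apply: contraR => /h.
- by apply: Or41 => x /h; rewrite negbK.
- by apply: Or42 => x; apply: contraTT => /h.
- by apply: Or43 => x /h; rewrite negbK.
- by apply: Or44 => x; apply: contraR; rewrite negbK => /h.
- exact: Or41.
- by apply: Or42 => x; apply: contraR => /h.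
Qed.

Lemma nested_compll (V : Type) (C D : V -> bool) :
  nested (compl C) D <-> nested C D.
Proof.
by split=> /nestedC h; apply: nestedC; [have /nested_complr := h | apply/nested_complr].
Qed.

Section Dunwoody.
Variables (V : eqType) (e : rel V).
Hypotheses (e_sym : symmetric e) (econn : conn e xpredT).
Implicit Types (C D X : V -> bool).

Definition inf C := forall s : seq V, exists2 x, C x & x \notin s.

Definition sepcut C := [/\ inf C, inf (compl C) & fin (bnd e C)].

Definition mincut C := sepcut C /\
  forall D, sepcut D -> ncard (bnd e C) <= ncard (bnd e D).

Definition crossing C : (V -> bool) -> Prop := fun D => mincut D /\ ~ nested C D.

Definition optcut C := mincut C /\
  forall D, mincut D -> ncard (crossing C) <= ncard (crossing D).

Lemma inf_sub C D : inf C -> (forall x, C x -> D x) -> inf D.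
Proof. by move=> iC CD s; have [x /CD Dx xs] := iC s; exists x. Qed.

Lemma infNI C D : inf C -> ~ inf (fun x => C x && D x) ->
  inf (fun x => C x && ~~ D x).
Proof.
move=> iC nCD s; apply: contrapT => ns; apply: nCD => s'.
have [x Cx] := iC (s ++ s'); rewrite mem_cat negb_or => /andP[xs xs'].
exists x => //; rewrite Cx; apply/negPn/negP => Dx; apply: ns; exists x => //.
by rewrite Cx.
Qed.

Lemma bnd_compl C : bnd e (compl C) = bnd e C.
Proof.
apply/predeqP => -[x y]; rewrite /bnd /compl /=.
by case: (C x); case: (C y).
Qed.

Lemma sepcut_compl C : sepcut C -> sepcut (compl C).
Proof. by case=> iC iC' fC; split; rewrite ?complK ?bnd_compl. Qed.

Lemma mincut_compl C : mincut C -> mincut (compl C).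
Proof. by case=> /sepcut_compl sC mC; split => // D; rewrite bnd_compl; apply: mC. Qed.

Lemma crossing_compl C : crossing (compl C) = crossing C.
Proof. by apply/predeqP => D; rewrite /crossing nested_compll. Qed.

Lemma optcut_compl C : optcut C -> optcut (compl C).
Proof.
case=> /mincut_compl mC oC; split=> // D; rewrite crossing_compl; exact: oC.
Qed.

Lemma bnd_nonempty C x y : C x -> ~~ C y -> exists p, bnd e C p.
Proof.
move=> Cx Cy; have [E [eE sE]] := conn_linked x y econn.
have [p /eE pE /andP[Cp Cp']] := sE C Cx Cy; exists p; split => //.
by rewrite Cp (negbTE Cp').
Qed.

(* A minimal cut splitting into two parts without edges between them would have
   an infinite part with a strictly smaller boundary. *)
Lemma mincut_conn C : mincut C -> conn e C.
Proof.
move=> [[iC iC' fC] mC] A x Cx Ax cl y Cy; apply: contrapT => nAy.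
pose C1 z := C z && `[< A z >]; pose C2 z := C z && ~~ `[< A z >].
have C1x : C1 x by rewrite /C1 Cx; apply/asboolP.
have C2y : C2 y by rewrite /C2 Cy; apply/asboolPn.
have part u v : e u v -> C u -> C v -> `[< A u >] = `[< A v >].
  move=> uv Cu Cv; apply/asboolP/asboolP; first exact: cl.
  by apply: cl => //; rewrite e_sym.
have sub1 p : bnd e C1 p -> bnd e C p \/ False.
  case: p => u v [/= uv ne]; left; split=> //=; apply: contra ne => /eqP Cuv.
  rewrite /C1; case Cu: (C u); rewrite -Cuv Cu //=; apply/eqP/part => //.
  by rewrite -Cuv.
have sub2 p : bnd e C2 p -> bnd e C p \/ False.
  case: p => u v [/= uv ne]; left; split=> //=; apply: contra ne => /eqP Cuv.
  rewrite /C2; case Cu: (C u); rewrite -Cuv Cu //=; apply/eqP; congr negb; apply/part => //.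
  by rewrite -Cuv.
have sub12 p : bnd e C1 p -> bnd e C2 p -> bnd e C p /\ False.
  case: p => u v [/= uv]; rewrite /C1 /C2 => ne1 [_ /=].
  case Cu: (C u) ne1; case Cv: (C v) => //=.
  - by rewrite (part _ _ uv Cu Cv) eqxx.
  - by case: `[< _ >].
  - by case: `[< _ >].
have fF : fin (fun _ : V * V => False) by exists [::].
have F0 : ncard (fun _ : V * V => False) = 0 by apply: ncard0 => z [].
have := ncard_submod fC fF sub1 sub2 sub12; rewrite F0 addn0 => le12.
have f1 : fin (bnd e C1) by apply: fin_sub fC _ => p /sub1[].
have f2 : fin (bnd e C2) by apply: fin_sub fC _ => p /sub2[].
have gt1 : 0 < ncard (bnd e C1).
  have [|p] := @bnd_nonempty C1 x y C1x; last exact: ncard_gt0.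
  by move: C2y; rewrite /C1 /C2 => /andP[_ /negbTE ->]; rewrite andbF.
have gt2 : 0 < ncard (bnd e C2).
  have [|p] := @bnd_nonempty C2 y x C2y; last exact: ncard_gt0.
  by move: C1x; rewrite /C1 /C2 => /andP[_ ->]; rewrite andbF.
case: (lem (inf C1)) => i1.
  have /mC : sepcut C1; last lia.
  by split => //; apply: inf_sub iC' _ => z; apply: contra => /andP[].
have /mC : sepcut C2; last lia.
split => //; first exact: infNI.
by apply: inf_sub iC' _ => z; apply: contra => /andP[].
Qed.

(** Minimal cuts and their complements are connected, and all have the boundary size of any one of
    them, which is the bound given to [tight_fin]. *)
Lemma mincut_edge_fin x y : e x y -> fin (fun C => [/\ mincut C, C x & ~~ C y]).
Proof.
move=> xy; case: (lem (exists C, mincut C)) => [[C0 m0]|n0]; last first.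
  by exists [::] => C [mC]; case: n0; exists C.
apply: fin_sub (tight_fin (ncard (bnd e C0)) e_sym xy) _ => C [mC Cx Cy].
split=> //; [exact: mincut_conn | exact: (mincut_conn (mincut_compl mC)) |].
by case: mC m0 => -[_ _ fC] mC [sC0 _]; split => //; apply: mC.
Qed.

(* A connected set avoiding all ends of boundary edges of [C] is nested with [C],
   so a crossing cut cuts an edge of a finite connected graph containing them. *)
Lemma crossing_fin C : fin (bnd e C) -> fin (crossing C).
Proof.
move=> [L bL]; case: (lem (exists x : V, True)) => [[x0 _]|nV]; last first.
  exists [::] => D [_ []]; apply: Or41 => x; case: nV; by exists x.
have [f fP] := choice (fun y => conn_linked x0 y econn).
pose E := flatten [seq f p.1 | p <- L].
have eE p : p \in E -> e p.1 p.2 by case/flatten_mapP => q _; case: (fP q.1) => h _; exact: h.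
pose F := E ++ [seq (p.2, p.1) | p <- E].
have eF p : p \in F -> e p.1 p.2.
  by rewrite mem_cat => /orP[/eE //|/mapP[q /eE qE ->]]; rewrite e_sym.
have fF : fin (fun D => exists2 p, p \in F & [/\ mincut D, D p.1 & ~~ D p.2]).
  by apply: fin_bigU => p /eF; exact: mincut_edge_fin.
apply: fin_sub fF _ => D [mD nD]; apply: contrapT => nF.
have same D' : (forall p, p \in E -> D' p.1 -> D' p.2) -> D' x0 ->
    forall p, bnd e C p -> D' p.1.
  move=> h D'0 p /bL pL; apply/negPn/negP => D'p.
  have [q qf /andP[D'q]] := (fP p.1).2 D' D'0 D'p.
  by rewrite h //; apply/flatten_mapP; exists p.
have avoid D' : conn e D' -> (forall p, bnd e C p -> ~~ D' p.1) -> nested C D'.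
  move=> cD' aD'; case: (lem (exists x, C x /\ D' x)) => [[x [Cx D'x]]|nx]; last first.
    by apply: Or43 => x Cx; apply/negP => D'x; apply: nx; exists x.
  apply: Or42 => y; move: y; apply: (cD' (fun z => C z) x) => // u v D'u D'v uv Cu.
  apply/negPn/negP => Cv; have /aD' : bnd e C (u, v) by split => //=; rewrite Cu (negbTE Cv).
  by rewrite /= D'u.
have inE' p : p \in E -> D p.1 = D p.2.
  move=> pE; apply/idP/idP => Dp; apply/negPn/negP => Dp'; apply: nF.
    by exists p; rewrite ?mem_cat ?pE.
  by exists (p.2, p.1) => //; rewrite mem_cat (map_f (fun p => (p.2, p.1)) pE) orbT.
apply: nD; case D0: (D x0).
  apply/nested_complr; apply: avoid; first exact: (mincut_conn (mincut_compl mD)).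
  by move=> p bp; rewrite /compl (same D) // => q /inE' ->.
apply: avoid; first exact: mincut_conn.
by move=> p; apply: (same (compl D)); rewrite /compl ?D0 // => q /inE' ->.
Qed.

Lemma bnd_andorb C D p :
  (bnd e (fun x => C x && D x) p -> bnd e C p \/ bnd e D p) /\
  (bnd e (fun x => C x || D x) p -> bnd e C p \/ bnd e D p) /\
  (bnd e (fun x => C x && D x) p -> bnd e (fun x => C x || D x) p ->
   bnd e C p /\ bnd e D p).
Proof.
case: p => x y; rewrite /bnd /=; split; [|split].
- case=> xy; case: (C x) (C y) (D x) (D y) => [] [] [] [] //= _; by [left | right].
- case=> xy; case: (C x) (C y) (D x) (D y) => [] [] [] [] //= _; by [left | right].
- case=> xy; by case: (C x) (C y) (D x) (D y) => [] [] [] [] //= _ [].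
Qed.

(** Both corners separate infinite sets, so neither boundary is below the minimum, while by
    submodularity they total at most twice the minimum. *)
Lemma mincut_corners C D : mincut C -> mincut D ->
  inf (fun x => C x && D x) -> inf (fun x => ~~ C x && ~~ D x) ->
  mincut (fun x => C x && D x) /\ mincut (fun x => C x || D x).
Proof.
move=> [[iC iC' fC] mC] [[iD iD' fD] mD] i1 i2.
have s1 : sepcut (fun x => C x && D x).
  split => //; first by apply: inf_sub iC' _ => x; rewrite /compl => /negbTE ->.
  by apply: fin_sub (finU fC fD) _ => p /(proj1 (bnd_andorb C D p)).
have s2 : sepcut (fun x => C x || D x).
  split; first by apply: inf_sub iC _ => x ->.
    by apply: inf_sub i2 _ => x; rewrite /compl negb_or.
  by apply: fin_sub (finU fC fD) _ => p /(proj1 (proj2 (bnd_andorb C D p))).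
have le : ncard (bnd e (fun x => C x && D x)) + ncard (bnd e (fun x => C x || D x))
    <= ncard (bnd e C) + ncard (bnd e D).
  by apply: ncard_submod => // p; case: (bnd_andorb C D p) => ? [].
have CD : ncard (bnd e C) = ncard (bnd e D) by apply/eqP; rewrite eqn_leq mC ?mD.
have := mC _ s1; have := mC _ s2.
by split; split => // X sX; apply: leq_trans (mC _ sX); lia.
Qed.

(** The point outside both sets excludes the mixed cases, such as [X] inside [C] with the complement
    of [D] inside [X]. *)
Lemma nested_andb C D X : nested C X -> nested D X ->
  (exists x, ~~ C x && ~~ D x) -> nested (fun x => C x && D x) X.
Proof.
move=> nC nD [z /andP[Cz Dz]].
case: nC => h; try by [apply: Or41 => x /andP[/h] | apply: Or43 => x /andP[/h]].
- case: nD => h'; try by [apply: Or41 => x /andP[_ /h'] | apply: Or43 => x /andP[_ /h']].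
    by apply: Or42 => x Xx; rewrite h ?h'.
  by case/negP: Cz; apply/h/h'.
- case: nD => h'; try by [apply: Or41 => x /andP[_ /h'] | apply: Or43 => x /andP[_ /h']].
    by case/negP: Dz; apply/h'/h.
  by apply: Or44 => x; rewrite negb_and => /orP[/h|/h'].
Qed.

Lemma nested_orb C D X : nested C X -> nested D X ->
  (exists x, C x && D x) -> nested (fun x => C x || D x) X.
Proof.
move=> /nested_compll nC /nested_compll nD [z /andP[Cz Dz]].
apply/nested_compll; have -> : compl (fun x => C x || D x) = (fun x => compl C x && compl D x).
  by apply: funext => x; rewrite /compl negb_or.
by apply: nested_andb => //; exists z; rewrite /compl Cz Dz.
Qed.

(** Bounds the double count: a cut crossing both corners must cross [C] and, by symmetry, [D]. *)
Lemma nested_corner C D X : nested C X ->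
  nested (fun x => C x && D x) X \/ nested (fun x => C x || D x) X.
Proof.
case=> h.
- by left; apply: Or41 => x /andP[/h].
- by right; apply: Or42 => x /h ->.
- by left; apply: Or43 => x /andP[/h].
- by right; apply: Or44 => x; rewrite negb_or => /andP[/h].
Qed.

Lemma inf_ex C : inf C -> exists x, C x.
Proof. by move=> /(_ [::])[x]; exists x. Qed.

(* If two optimal cuts crossed, opposite corners would be minimal cuts crossed by
   strictly fewer minimal cuts in total. *)
Lemma optcut_corner_nested C D : optcut C -> optcut D ->
  inf (fun x => C x && D x) -> inf (fun x => ~~ C x && ~~ D x) -> nested C D.
Proof.
move=> [mC oC] [mD oD] i1 i2; apply: contrapT => nCD.
have [m1 m2] := mincut_corners mC mD i1 i2.
have := oC _ m1; have := oD _ m2.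
have fC : fin (crossing C) by apply: crossing_fin; case: mC => -[].
have fD : fin (crossing D) by apply: crossing_fin; case: mD => -[].
have : ncard (crossing (fun x => C x && D x)) + ncard (crossing (fun x => C x || D x))
   < ncard (crossing C) + ncard (crossing D); last lia.
(* The strict gain is [C] itself: it crosses [D] but is nested with both corners. *)
apply: (ncard_submod_lt (z0 := C)) => //.
- move=> X [mX nX]; apply: contrapT => h; apply: nX; apply: nested_andb.
  + by apply: contrapT => h'; apply: h; left.
  + by apply: contrapT => h'; apply: h; right.
  + exact: inf_ex i2.
- move=> X [mX nX]; apply: contrapT => h; apply: nX; apply: nested_orb.
  + by apply: contrapT => h'; apply: h; left.
  + by apply: contrapT => h'; apply: h; right.
  + exact: inf_ex i1.
- move=> X [mX n1] [_ n2]; split; split => // h.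
    by case: (nested_corner D h).
  case: (nested_corner C h) => h'; [apply: n1|apply: n2].
    by congr nested: h'; apply: funext => x; rewrite andbC.
  by congr nested: h'; apply: funext => x; rewrite orbC.
- by right; split => // /nestedC.
- by case=> _; apply; apply: Or41 => x /andP[].
- by case=> _; apply; apply: Or42 => x ->.
Qed.

(** Both sets and their complements are infinite, so if one corner is finite, the two corners next
    to it are infinite. Hence some pair of opposite corners is infinite, if necessary after
    complementing [D]. *)
Lemma optcut_nested C D : optcut C -> optcut D -> nested C D.
Proof.
move=> oC oD.
case: (lem (inf (fun x => C x && D x) /\ inf (fun x => ~~ C x && ~~ D x))) => [[]|n1].
  exact: optcut_corner_nested.
have [iC iC' _] := oC.1.1; have [iD iD' _] := oD.1.1.
apply/nested_complr; apply: optcut_corner_nested => //; first exact: optcut_compl.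
  case: (lem (inf (fun x => C x && D x))) => [i1|]; last exact: infNI.
  apply: contrapT => i2; apply: n1; split=> //.
  have := infNI iD'; rewrite /compl => h.
  have -> : (fun x => ~~ C x && ~~ D x) = (fun x => ~~ D x && ~~ C x).
    by apply: funext => x; exact: andbC.
  apply: h => h; apply: i2; congr inf: h; apply: funext => x; exact: andbC.
rewrite /compl; case: (lem (inf (fun x => ~~ C x && ~~ D x))) => [i1|]; last exact: infNI.
apply: contrapT => i2; apply: n1; split=> //.
have -> : (fun x => C x && D x) = (fun x => D x && ~~ ~~ C x).
  by apply: funext => x; rewrite negbK andbC.
apply: infNI => // h; apply: i2; congr inf: h; apply: funext => x; by rewrite negbK andbC.
Qed.

Lemma optcut_ex C : sepcut C -> exists D, optcut D.
Proof.
move=> sC.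
have [|n [[D [sD <-]] nmin]] := @min_nat (fun n => exists D, sepcut D /\ ncard (bnd e D) = n).
  by exists (ncard (bnd e C)), C.
have mD : mincut D by split => // X sX; apply: nmin; exists X.
have [|m [[X [mX <-]] mmin]] := @min_nat (fun n => exists D, mincut D /\ ncard (crossing D) = n).
  by exists (ncard (crossing D)), D.
by exists X; split=> // Y mY; apply: mmin; exists Y.
Qed.

(** * Invariance of the cuts under automorphisms *)

Section Automorphisms.
Variables (g h : V -> V).
Hypotheses (gK : cancel g h) (hK : cancel h g) (ge : forall x y, e (g x) (g y) = e x y).

Let he x y : e (h x) (h y) = e x y. Proof. by rewrite -ge !hK. Qed.

Lemma nested_comp C D : nested (C \o g) D <-> nested C (D \o h).
Proof.
split; case=> H; [apply: Or41 | apply: Or42 | apply: Or43 | apply: Or44 |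
  apply: Or41 | apply: Or42 | apply: Or43 | apply: Or44] => x /=.
- by move=> Cx; apply: H; rewrite /= hK.
- by move/H; rewrite /= hK.
- by move=> Cx; apply: H; rewrite /= hK.
- by move=> Cx; apply: H; rewrite /= hK.
- by move/H; rewrite /= gK.
- by move=> Cx; apply: H; rewrite /= gK.
- by move/H; rewrite /= gK.
- by move/H; rewrite /= gK.
Qed.

Lemma inf_comp C : inf C -> inf (C \o g).
Proof.
move=> iC s; have [x Cx xs] := iC (map g s); exists (h x); rewrite /= ?hK //.
by apply: contra xs => /(map_f g); rewrite hK.
Qed.

Lemma sepcut_comp C : sepcut C -> sepcut (C \o g).
Proof.
case=> iC iC' fC; split; [exact: inf_comp| exact: (inf_comp iC') |].
apply: (fin_map (f := fun p => (h p.1, h p.2)) fC) => -[x y] [/= xy ne].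
by exists (g x, g y); rewrite /= ?gK //; split; rewrite /= ?ge.
Qed.

Lemma ncard_bnd_comp C : fin (bnd e C) -> ncard (bnd e (C \o g)) = ncard (bnd e C).
Proof.
move=> fC; apply/esym.
apply: (@ncard_bij _ _ _ _ (fun p => (h p.1, h p.2)) (fun p => (g p.1, g p.2))) => //.
- by move=> [x y] [/= xy ne]; split; rewrite /= ?he ?hK.
- by move=> [x y] [/= xy ne]; split; rewrite /= ?ge.
- by move=> [x y]; rewrite /= !hK.
- by move=> [x y]; rewrite /= !gK.
Qed.

Lemma mincut_comp C : mincut C -> mincut (C \o g).
Proof.
move=> [sC mC]; split; first exact: sepcut_comp.
by move=> D sD; rewrite ncard_bnd_comp; [exact: mC | case: sC].
Qed.

End Automorphisms.

Lemma optcut_comp (g h : V -> V) C : cancel g h -> cancel h g ->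
  (forall x y, e (g x) (g y) = e x y) -> optcut C -> optcut (C \o g).
Proof.
move=> gK hK ge [mC oC]; have he x y : e (h x) (h y) = e x y by rewrite -ge !hK.
split; first exact: (mincut_comp gK hK ge).
move=> D mD; apply: leq_trans (oC D mD).
rewrite (@ncard_bij _ _ (crossing C) (crossing (C \o g)) (fun D => D \o g) (fun D => D \o h)) //.
- move=> X [mX nX]; split; first exact: (mincut_comp gK hK ge).
  move/(nested_comp gK hK) => H; apply: nX; congr nested: H.
  by apply: funext => x /=; rewrite hK.
- move=> X [mX nX]; split; first exact: (mincut_comp hK gK he).
  by move=> H; apply: nX; apply/(nested_comp gK hK).
- by move=> X; apply: funext => x /=; rewrite hK.
- by move=> X; apply: funext => x /=; rewrite gK.
- by apply: crossing_fin; case: mC => -[].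
Qed.

End Dunwoody.

(** * Gromov products in the structure tree *)

Section GromovProduct.
Variables (V : eqType) (e : rel V).
Hypotheses (e_sym : symmetric e) (econn : conn e xpredT).

Definition splits (x a b : V) : (V -> bool) -> Prop :=
  fun C => [/\ optcut e C, C x, ~~ C a & ~~ C b].

(* The Gromov product of [a] and [b] at [x] in the structure tree of the optimal
   cuts; [gp x a a] is the distance from [x] to [a]. *)
Definition gp (x a b : V) : nat := ncard (splits x a b).

Lemma gpC x a b : gp x a b = gp x b a.
Proof. by apply: eq_ncard => C; split; case. Qed.

Lemma splits_fin x a b : e x a -> fin (splits x a b).
Proof.
move=> xa; apply: fin_sub (mincut_edge_fin e_sym econn xa) _ => C [[mC _] Cx Ca _].
by split.
Qed.

Lemma splits_finr x a b : e x b -> fin (splits x a b).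
Proof. by move=> xb; apply: fin_sub (splits_fin a xb) _ => C []. Qed.

Lemma gp_comp g h x a b : cancel g h -> cancel h g ->
  (forall x y, e (g x) (g y) = e x y) -> e x a -> gp (g x) (g a) (g b) = gp x a b.
Proof.
move=> gK hK ge xa; have he u v : e (h u) (h v) = e u v by rewrite -ge !hK.
rewrite /gp; apply: (@ncard_bij _ _ (splits (g x) (g a) (g b)) (splits x a b)
  (fun C => C \o g) (fun C => C \o h)).
- by move=> C [oC Cx Ca Cb]; split => //; apply: (optcut_comp e_sym econn gK hK ge).
- move=> C [oC Cx Ca Cb]; split; rewrite /= ?gK //.
  exact: (optcut_comp e_sym econn hK gK he).
- by move=> C; apply: funext => y /=; rewrite hK.
- by move=> C; apply: funext => y /=; rewrite gK.
- by apply: splits_fin; rewrite ge.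
Qed.

Lemma ncard_compl (P Q : (V -> bool) -> Prop) : fin P ->
  (forall C, P C -> Q (compl C)) -> (forall C, Q C -> P (compl C)) -> ncard P = ncard Q.
Proof. by move=> fP PQ QP; apply: (ncard_bij PQ QP) => //; exact: complK. Qed.

Lemma gp_rev x a : e x a -> gp x a a = gp a x x.
Proof.
move=> xa; rewrite /gp; apply: ncard_compl; first exact: splits_fin.
  by move=> C [oC Cx Ca _]; split; rewrite /compl ?negbK //; exact: optcut_compl.
by move=> C [oC Cx Ca _]; split; rewrite /compl ?negbK //; exact: optcut_compl.
Qed.

(** The ultrametric inequality of a tree. If a cut [C0] has [x], [c] on one side and [a], [b] on the
    other, nestedness makes every cut separating [x] from [b] and [c] separate it from [a] too.
    Otherwise every cut separating [x] from [a] and [b] also separates it from [c]. *)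
Lemma gp_ultra x a b c : e x c -> gp x a b <= gp x a c \/ gp x b c <= gp x a c.
Proof.
move=> xc; case: (lem (exists C, splits x a b C /\ C c)) => [[C0 [[o0 C0x C0a C0b] C0c]]|nC].
  right; apply: ncard_le => [|C [oC Cx Cb Cc]]; first exact: splits_finr.
  split=> //; case: (optcut_nested e_sym econn oC o0) => h.
  - by apply: contra C0a => /h.
  - by rewrite h in Cc.
  - by have := h x Cx; rewrite C0x.
  - by have := h b Cb; rewrite (negbTE C0b).
left; apply: ncard_le => [|C sC]; first exact: splits_finr.
case: (sC) => oC Cx Ca Cb; split => //; apply/negP => Cc; apply: nC; by exists C.
Qed.

(** The cuts between [x] and [y] are sorted by the side on which [a] lies. *)
Lemma gp_turn x y a : e x y -> gp x a y + gp y a x = gp x y y.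
Proof.
move=> xy; rewrite [gp x y y](ncard_split (fun C => ~~ C a) (splits_fin y xy)); congr addn.
  by apply: eq_ncard => C; split; [case=> *; split | case; case=> *; split].
apply: ncard_compl; first by apply: splits_finr; rewrite e_sym.
  move=> C [oC Cy Ca Cx]; rewrite /compl; split.
    by split; rewrite ?negbK //; exact: optcut_compl.
  by move/negP; rewrite Ca.
move=> C [[oC Cx Cy _] /negP/negPn Ca]; split; rewrite /compl ?negbK //; exact: optcut_compl.
Qed.

Lemma gp_triangle x a b t : (forall u v, e u v -> gp u v v = t) ->
  e x a -> e x b -> e a b -> (gp x a b).*2 = t.
Proof.
move=> tP xa xb ab.
have := gp_turn b xa; have := gp_turn a xb; have := gp_turn x ab.
rewrite !tP // (gpC x b a) (gpC a x b) (gpC b x a) -addnn; lia.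
Qed.

(* The smallest of finitely many comparable cuts would isolate [x] from all its
   neighbours, although optimal cuts are connected and infinite. *)
Lemma gp_star x a : fin (fun b => e x b) -> e x a ->
  ~ (forall b, e x b -> 0 < gp x a b).
Proof.
move=> [L eL] xa pos.
have [C [oC Cx _ _] CL] : exists2 C, splits x a a C & forall b, b \in L -> e x b -> ~~ C b.
  elim: L {eL} => [|b L [C sC CL]]; first by have [C sC] := ncard_ex (pos a xa); exists C.
  have [xb|nxb] := boolP (e x b); last first.
    exists C => // c; rewrite inE => /orP[/eqP-> xb|/CL //]; by rewrite xb in nxb.
  have [D [oD Dx Da Db]] := ncard_ex (pos b xb); case: (sC) => oC Cx Ca _.
  case: (optcut_nested e_sym econn oC oD) => h.
  - exists C => // c; rewrite inE => /orP[/eqP-> _|/CL //]; by apply: contra Db => /h.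
  - exists D => // c; rewrite inE => /orP[/eqP-> //|cL xc].
    by apply: contra (CL c cL xc) => /h.
  - by have := h x Cx; rewrite Dx.
  - by have := h a Ca; rewrite (negbTE Da).
have [infC _ _] := oC.1.1; have [z Cz] := infC [:: x]; rewrite inE => /eqP; apply.
apply: (mincut_conn e_sym econn oC.1 (A := fun z => z = x) Cx) => // u v Cu Cv uv ux.
by rewrite ux in uv; have := CL v (eL v uv) uv; rewrite Cv.
Qed.

End GromovProduct.

(** * Homogeneous digraphs with triangles *)

Definition uadj (V : Type) (arc : rel V) : rel V := fun x y => arc x y || arc y x.

Definition aut (V : Type) (arc : rel V) (g : V -> V) : Prop :=
  bijective g /\ forall x y, arc (g x) (g y) = arc x y.

Lemma uadjC (V : Type) (arc : rel V) : symmetric (uadj arc).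
Proof. by move=> x y; exact: orbC. Qed.

Lemma aut_uadj (V : Type) (arc : rel V) g : aut arc g ->
  forall x y, uadj arc (g x) (g y) = uadj arc x y.
Proof. by move=> [_ ga] x y; rewrite /uadj !ga. Qed.

(* Double counting of arcs in a regular tournament. *)
Lemma regular_tournament_odd (T : eqType) (r : rel T) (L : seq T) d : uniq L ->
  (forall u v, u \in L -> v \in L -> r u v + r v u + (u == v) = 1) ->
  (forall u, u \in L -> count (r u) L = d) -> L = [::] \/ odd (size L).
Proof.
move=> uL tr reg.
have cnt u : \sum_(v <- L) r u v = count (r u) L.
  by rewrite -sum1_count [RHS]big_mkcond; apply: eq_bigr => v _; case: (r u v).
have S1 : \sum_(u <- L) \sum_(v <- L) r u v = size L * d.
  rewrite (eq_big_seq (fun=> d)) => [|u uL']; last by rewrite cnt reg.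
  by rewrite big_const_seq count_predT iter_addn_0 mulnC.
have S2 : \sum_(u <- L) \sum_(v <- L) r v u = size L * d by rewrite exchange_big.
have S3 : \sum_(u <- L) \sum_(v <- L) (u == v) = size L.
  rewrite (eq_big_seq (fun=> 1)) => [|u uL'].
    by rewrite big_const_seq count_predT iter_addn_0 mul1n.
  rewrite (bigD1_seq u) //= eqxx big1 ?addn0 // => v; by rewrite eq_sym => /negbTE ->.
have : \sum_(u <- L) \sum_(v <- L) (r u v + r v u + (u == v)) = size L * size L.
  rewrite (eq_big_seq (fun=> size L)) => [|u uL'].
    by rewrite big_const_seq count_predT iter_addn_0.
  rewrite (eq_big_seq (fun=> 1)) => [|v vL]; last exact: tr.
  by rewrite big_const_seq count_predT iter_addn_0 mul1n.
under eq_bigr do rewrite !big_split /=.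
rewrite !big_split /= S1 S2 S3 => E.
case: L {uL tr reg cnt S1 S2 S3} E => [|a L] E; [by left | right].
have -> : size (a :: L) = d.*2.+1; last by rewrite /= odd_double.
apply/eqP; rewrite -(eqn_pmul2l (m := size (a :: L))) // -E; apply/eqP.
by rewrite -addnn; lia.
Qed.

Section Homogeneous.
Variables (V : eqType) (arc : rel V).
Local Notation e := (uadj arc).
Hypotheses (irr : forall x, arc x x = false)
  (asym : forall x y, arc x y -> arc y x = false)
  (econn : conn e xpredT) (locfin : forall x, fin (fun y => e x y)).
Hypothesis vtrans : forall x y, exists2 g, aut arc g & g x = y.
(** The case [a = b] is allowed, so arc-transitivity is included. *)
Hypothesis star2 : forall x a b x' a' b',
  e x a -> e x b -> e x' a' -> e x' b' -> arc x a = arc x' a' -> arc x b = arc x' b' ->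
  (a == b) = (a' == b') -> arc a b = arc a' b' -> arc b a = arc b' a' ->
  exists2 g, aut arc g & [/\ g x = x', g a = a' & g b = b'].

Let e_sym := @uadjC V arc.

(** Automorphisms preserving [P] and transitive on it make all out-degrees inside [P] equal. *)
Lemma tournament_odd (P : V -> Prop) : fin P ->
  (forall u v, P u -> P v -> u != v -> e u v) ->
  (forall u v, P u -> P v -> exists2 g, aut arc g & g u = v /\ forall z, P (g z) <-> P z) ->
  ncard P = 0 \/ odd (ncard P).
Proof.
move=> fP tP trP; have [L lL] := finE fP; rewrite (ncardE lL); case: (lL) => uL PL.
case: L uL lL PL => [|w L'] uL lL PL; first by left.
set L := w :: L' in uL lL PL *.
have [] // := @regular_tournament_odd _ arc L (count (arc w) L) uL; last by right.
- move=> u v /PL Pu /PL Pv; have [->|uv] := eqVneq u v; first by rewrite !irr.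
  have := tP u v Pu Pv uv; rewrite /uadj; case uv': (arc u v); first by rewrite (asym uv').
  by move=> /= ->.
- move=> u /PL Pu; have Pw : P w by apply/PL; rewrite mem_head.
  have [g [gb ga] [gu gP]] := trP u w Pu Pw; have [h gK hK] := gb.
  have E z : lists (fun y => P y /\ arc z y) (filter (arc z) L).
    split; first exact: filter_uniq.
    by move=> y; rewrite mem_filter andbC; split => [[/PL -> ->]|/andP[/PL]].
  rewrite -!size_filter -(ncardE (E u)) -(ncardE (E w)).
  apply: (ncard_bij (f := g) (g := h)) => //.
  + by move=> z [Pz uz]; rewrite gP -gu ga.
  + by move=> z [Pz wz]; rewrite -gP hK; split=> //; rewrite -(ga u) gu hK.
  + by apply: fin_sub fP _ => z [].
Qed.

Hypothesis sep : exists C, sepcut e C.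
Hypothesis tri : exists x y z, [/\ e x y, e y z & e x z].

Lemma arc_trans x y x' y' : arc x y -> arc x' y' ->
  exists2 g, aut arc g & g x = x' /\ g y = y'.
Proof.
move=> xy xy'; have := @star2 x y y x' y' y'; rewrite /uadj xy xy' !irr !eqxx.
by case=> // g ga [gx gy _]; exists g.
Qed.

Lemma gp_aut g x a b : aut arc g -> e x a -> gp e (g x) (g a) (g b) = gp e x a b.
Proof.
move=> ga xa; have [[h gK hK] _] := ga.
exact: (gp_comp e_sym econn b gK hK (aut_uadj ga) xa).
Qed.

(** Positivity holds because an optimal cut exists and, by connectedness, cuts some edge. *)
Lemma step_ex : exists2 t, 0 < t & forall u v, e u v -> gp e u v v = t.
Proof.
have [x [y [_ [xy _ _]]]] := tri.
wlog {xy} xy : x y / arc x y.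
  by move=> h; case/orP: xy; exact: h.
have exy : e x y by rewrite /uadj xy.
have cst u v : e u v -> gp e u v v = gp e x y y.
  wlog uv : u v / arc u v.
    move=> h /orP[uv|uv]; first by apply: h; rewrite // /uadj uv.
    rewrite (gp_rev e_sym econn) ?h // /uadj uv ?orbT //.
  move=> _; have [g ga [<- <-]] := arc_trans xy uv; exact: gp_aut.
exists (gp e x y y) => //; have [C0 sC0] := sep; have [C oC] := optcut_ex sC0.
have [[iC iC' _] _] := oC.1; have [[u Cu] [v Cv]] := (inf_ex iC, inf_ex iC').
have [[a b] [/= ab ne]] := bnd_nonempty econn Cu Cv.
wlog Ca : a b ab ne / C a.
  move=> h; case Ca: (C a); first exact: (h a b).
  by apply: (h b a); rewrite 1?e_sym 1?eq_sym //; move: ne; rewrite Ca; case: (C b).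
rewrite -(cst a b ab); apply: (ncard_gt0 (z := C)); first exact: splits_fin.
by split => //; move: ne; rewrite Ca; case: (C b).
Qed.

(** Every triangle, cyclic or transitive, has a vertex with one arc in and one arc out;
    vertex-transitivity moves it to [x]. *)
Lemma mixed_triangle x o : exists c d, [/\ e x c, e x d, e c d, arc x c = o & arc x d = ~~ o].
Proof.
have [y [c [d [yc yd cd yct ydt]]]] : exists y c d,
    [/\ e y c, e y d, e c d, arc y c = true & arc y d = false].
  have [a [b [c [ab bc ac]]]] := tri.
  have rev u v : e u v -> arc u v = false -> arc v u by move=> /orP[->|].
  have ba := ab; have cb := bc; have ca := ac.
  rewrite e_sym in ba; rewrite e_sym in cb; rewrite e_sym in ca.
  case ab': (arc a b); case bc': (arc b c); case ac': (arc a c).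
  - by exists b, c, a; split=> //; exact: asym.
  - by exists a, b, c.
  - by exists c, b, a; split=> //; [exact: rev | exact: asym].
  - by exists a, b, c.
  - by exists a, c, b.
  - by exists c, a, b; split=> //; [exact: rev | exact: asym].
  - by exists a, c, b.
  - by exists b, a, c; split=> //; exact: rev.
have [g ga <-] := vtrans y x.
case: o; [exists (g c), (g d) | exists (g d), (g c)]; rewrite !(aut_uadj ga) !ga.2 yct ydt yc yd //.
by rewrite e_sym cd.
Qed.

Variable t : nat.
Hypotheses (t_gt0 : 0 < t) (tP : forall u v, e u v -> gp e u v v = t).

Lemma gp_adj x a b : e x a -> e x b -> e a b -> (gp e x a b).*2 = t.
Proof. exact: (gp_triangle e_sym econn tP). Qed.

Lemma gp_near_trans x a b c : e x c ->
  t <= (gp e x a b).*2 -> t <= (gp e x b c).*2 -> t <= (gp e x a c).*2.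
Proof.
move=> xc ab bc; case: (gp_ultra e_sym econn a b xc); rewrite -leq_double => h.
  exact: leq_trans h.
exact: leq_trans h.
Qed.

(* Otherwise all neighbours of [x] would lie in one branch at [x]: homogeneity
   spreads the relation over whole neighbourhoods [N^+ x] and [N^- x], and
   triangles connect these two. *)
Lemma gp_nonadj x a b : e x a -> e x b -> a != b -> ~~ e a b -> (gp e x a b).*2 < t.
Proof.
move=> xa xb neab nab; rewrite ltnNge; apply/negP => ab.
have near c d : e x c -> e x d -> arc x c = arc x a -> arc x d = arc x b ->
    t <= (gp e x c d).*2.
  move=> xc xd xca xdb; have [->|cd] := eqVneq c d; first by rewrite tP // -addnn leq_addr.
  have [ecd|/norP[ncd ndc]] := boolP (e c d); first by rewrite gp_adj.
  have /norP[nab' nba'] := nab.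
  have [] // := @star2 x a b x c d.
  - by rewrite (negbTE cd) (negbTE neab).
  - by rewrite (negbTE nab') (negbTE ncd).
  - by rewrite (negbTE nba') (negbTE ndc).
  by move=> g ga [gx gc gd]; rewrite -{1}gx -gc -gd gp_aut.
have far c : e x c -> ~ (forall d, e x d -> t <= (gp e x c d).*2).
  move=> xc h; apply: (gp_star e_sym econn (locfin x) xc) => d /h.
  by case: (gp e x c d) => //; rewrite leqNgt t_gt0.
have [abo|abo] := eqVneq (arc x a) (arc x b).
  (* Equal orientations: [near] covers the neighbours oriented like [a], and the mixed triangle
     reaches the others. *)
  have [c [d [xc xd cd oc od]]] := mixed_triangle x (arc x a).
  apply: (far c xc) => f xf; have [fo|fo] := eqVneq (arc x f) (arc x a).
    by apply: near; rewrite -?abo.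
  have df : arc x d = arc x f by rewrite od; move: fo; case: (arc x f); case: (arc x a).
  have [] // := @star2 x d d x f f; rewrite ?eqxx ?irr // => g ga [gx gd _].
  have xgc : e x (g c) by rewrite -{1}gx (aut_uadj ga).
  apply: (gp_near_trans (b := g c)) => //.
    by apply: near; rewrite // -?abo // -{1}gx ga.2.
  by rewrite gp_adj // -gd (aut_uadj ga).
(* Opposite orientations: [near] compares [a] with the neighbours oriented like [b], and [b] links
   it to those oriented like [a]. *)
apply: (far a xa) => f xf; have [fo|fo] := eqVneq (arc x f) (arc x b).
  exact: near.
apply: (gp_near_trans (b := b)) => //; rewrite gpC; apply: near => //.
by move: fo abo; case: (arc x f); case: (arc x a); case: (arc x b).
Qed.

Lemma clique_trans x a b c : e x a -> e x b -> e x c -> e a b -> e b c -> a != c -> e a c.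
Proof.
move=> xa xb xc ab bc ac; apply/negPn/negP => nac.
have := gp_nonadj xa xc ac nac; rewrite ltnNge => /negP; apply.
by apply: (gp_near_trans (b := b)) => //; rewrite gp_adj.
Qed.

(** Sort the common neighbours of [s] and [x] by their arcs. In the clique, [s] has out-degree 1 +
    |Q| + |B| and [x] has |R| + |B|, and these agree since an automorphism maps the arc [s x] to
    [x c]. So |R| = |Q| + 1. But [Q] and [R] are each empty or of odd size, and a transitive
    triangle makes [Q] non-empty. *)
Lemma no_transitive_triangle s x c : arc s x -> arc x c -> arc s c -> False.
Proof.
move=> sx xc sc.
have esx : e s x by rewrite /uadj sx.
have exs : e x s by rewrite e_sym.
pose Q v := arc s v && arc v x; pose R v := arc v s && arc x v.
pose B v := arc s v && arc x v.
have fe y (P : V -> bool) : (forall v, P v -> e y v) -> fin (fun v => P v).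
  by move=> h; apply: fin_sub (locfin y) h.
have fQ : fin (fun v => Q v) by apply: (fe s) => v /andP[sv _]; rewrite /uadj sv.
have fR : fin (fun v => R v) by apply: (fe x) => v /andP[_ xv]; rewrite /uadj xv.
have fB : fin (fun v => B v) by apply: (fe x) => v /andP[_ xv]; rewrite /uadj xv.
have oQ : ncard (fun v => Q v) = 0 \/ odd (ncard (fun v => Q v)).
  apply: tournament_odd => // [u v /andP[su ux] /andP[sv vx] uv|u v /andP[su ux] /andP[sv vx]].
    by apply: (clique_trans (x := s) (b := x)); rewrite // /uadj ?su ?sv ?ux ?vx ?orbT.
  have := @star2 s x u s x v; rewrite /uadj sx su sv ux vx (asym ux) (asym vx).
  have [xu|_] := eqVneq x u; first by rewrite -xu irr in ux.
  have [xv|_] := eqVneq x v; first by rewrite -xv irr in vx.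
  case=> // g ga [gs gx gu]; exists g => //; split => // z.
  by rewrite /Q -{1}gs -{1}gx !ga.2.
have oR : ncard (fun v => R v) = 0 \/ odd (ncard (fun v => R v)).
  apply: tournament_odd => // [u v /andP[us xu] /andP[vs xv] uv|u v /andP[us xu] /andP[vs xv]].
    by apply: (clique_trans (x := s) (b := x)); rewrite // /uadj ?us ?vs ?xu ?xv ?orbT.
  have := @star2 s x u s x v; rewrite /uadj sx us vs xu xv.
  rewrite !(asym us) !(asym vs) (asym xu) (asym xv).
  have [xu'|_] := eqVneq x u; first by rewrite -xu' irr in xu.
  have [xv'|_] := eqVneq x v; first by rewrite -xv' irr in xv.
  case=> // g ga [gs gx gu]; exists g => //; split => // z.
  by rewrite /R -{1}gs -{1}gx !ga.2.
(* An automorphism taking the long arc [s c] to [s x] moves [x] between [s] and [x]. *)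
have Q0 : 0 < ncard (fun v => Q v).
  have [g ga [gs gc]] := arc_trans sc sx.
  apply: (ncard_gt0 (z := g x)) => //; rewrite /Q.
  by have := ga.2 s x; have := ga.2 x c; rewrite gs gc => -> ->; rewrite sx xc.
(* Out-degrees of [s] and [x] in the clique containing the triangle agree. *)
pose K u w v := arc u v && ((v == w) || e v w).
have fK u w : fin (fun v => K u w v) by apply: (fe u) => v /andP[uv _]; rewrite /uadj uv.
have deg : ncard (fun v => K s x v) = ncard (fun v => K x c v).
  have [g ga [gs gx]] := arc_trans sx xc; have [[h gK hK] _] := ga.
  have Kg z : K x c (g z) = K s x z.
    by rewrite /K -(ga.2 s z) gs -(aut_uadj ga z x) gx -(inj_eq (can_inj gK) z x) gx.
  by apply: (ncard_bij (f := g) (g := h)) => // z; rewrite -?Kg ?hK.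
have degs : ncard (fun v => K s x v) = 1 + (ncard (fun v => Q v) + ncard (fun v => B v)).
  rewrite (ncard_split (fun v => v = x) (fK s x)); congr addn.
    apply: (@ncardE _ _ [:: x]); split => // v; rewrite inE; split; first by case=> _ ->.
    by move/eqP ->; rewrite /K sx eqxx.
  have fK' : fin (fun v => K s x v /\ v <> x) by apply: fin_sub (fK s x) _ => v [].
  rewrite (ncard_split (fun v => arc v x) fK'); congr addn; apply: eq_ncard => v.
    rewrite /K /Q; split; first by case=> -[/andP[-> _] _] ->.
    case/andP => sv vx; rewrite sv /uadj vx orbT; split => //; split => // vx'.
    by rewrite vx' irr in vx.
  rewrite /K /B; split.
    by case=> -[/andP[-> /orP[/eqP //|]]]; rewrite /uadj => /orP[->|->].
  case/andP => sv xv; rewrite sv /uadj xv !orbT; split; last by rewrite asym.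
  by split => // vx; rewrite vx irr in xv.
have degx : ncard (fun v => K x c v) = ncard (fun v => R v) + ncard (fun v => B v).
  rewrite (ncard_split (fun v => arc v s) (fK x c)).
  have exc : e x c by rewrite /uadj xc.
  have esc : e s c by rewrite /uadj sc.
  have Ks v : K x c v = arc x v && e v s.
    rewrite /K; case xv: (arc x v) => //=; have exv : e x v by rewrite /uadj xv.
    have vs : v != s by apply/negP => /eqP vs; rewrite vs (asym sx) in xv.
    have [->|vc] /= := eqVneq v c; first by rewrite e_sym esc.
    apply/idP/idP => h; first by apply: (clique_trans (x := x) (b := c)); rewrite // e_sym.
    by apply: (clique_trans (x := x) (b := s)).
  congr addn; apply: eq_ncard => v; rewrite Ks /uadj.
    by rewrite /R; split; [case=> /andP[-> _] -> | case/andP => -> ->].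
  rewrite /B; split; first by case=> /andP[-> /orP[//|->]].
  by case/andP => sv ->; rewrite sv orbT; split => //; rewrite asym.
move: deg oQ oR Q0; rewrite degs degx => /eqP.
rewrite addnA eqn_add2r => /eqP <-; rewrite add1n /=.
by case=> [->//|-> ] [].
Qed.

(** A second common neighbour [w] would be adjacent to [z]; as both have arcs into [x], the triangle
    [w z x] would be transitive. *)
Lemma cyclic_triangle x y : arc x y ->
  exists z, [/\ arc y z, arc z x & forall w, e x w -> e y w -> w = z].
Proof.
move=> xy.
have cyc w : e x w -> e y w -> arc y w /\ arc w x.
  move=> /orP[xw|wx] /orP[yw|wy] //.
  - by case: (no_transitive_triangle xy yw xw).
  - by case: (no_transitive_triangle xw wy xy).
  - by case: (no_transitive_triangle wx xy wy).
have [c [d [yc yd cd oc od]]] := mixed_triangle y true.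
have [g ga [gy gc]] := arc_trans oc xy.
have [ez1 ez2] : e x (g d) /\ e y (g d) by rewrite -{1}gc -gy !(aut_uadj ga).
have [yz zx] := cyc _ ez1 ez2; exists (g d); split => // w xw yw.
have [yw' wx] := cyc _ xw yw; apply/eqP/negPn/negP => wz.
have exy : e x y by rewrite /uadj xy.
have /orP[h|h] : e w (g d) by apply: (clique_trans (x := x) (b := y)); rewrite // e_sym.
  by case: (no_transitive_triangle h zx wx).
by case: (no_transitive_triangle h wx zx).
Qed.

(** Seen from [v], the tree path to [x] follows the one to [u] for more than half a step: [u] is the
    way back to [x]. *)
Definition toward (x v u : V) : Prop := t < (gp e v x u).*2.

Lemma toward_irr x u : ~ toward x x u.
Proof. by rewrite /toward /gp ncard0 // => C [_ -> ]. Qed.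

Lemma toward0 x u : e x u -> toward x u x.
Proof. by move=> xu; rewrite /toward tP 1?e_sym // -addnn -{1}[t]addn0 ltn_add2l. Qed.

(** Two such neighbours would have product above t/2 with each other, more than adjacent or
    non-adjacent distinct neighbours can have. *)
Lemma toward_uniq x v u u' : e v u -> e v u' -> toward x v u -> toward x v u' -> u = u'.
Proof.
move=> vu vu'; rewrite /toward (gpC _ v x u) => h h'; apply/eqP/negPn/negP => uu'.
have : t < (gp e v u u').*2.
  by case: (gp_ultra e_sym econn u x vu'); rewrite -leq_double; apply: leq_trans.
have [a|na] := boolP (e u u'); first by rewrite gp_adj // ltnn.
by have := gp_nonadj vu vu' uu' na; rewrite ltnNge => /negP h1 /ltnW.
Qed.

(** The product of [u] and [w] at [v] is below t/2, hence so is that of [x] and [w]; by [gp_turn]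
    the complementary product at [w] exceeds t/2. *)
Lemma toward_step x v u w : e v u -> e v w -> u != w -> ~~ e u w -> toward x v u ->
  toward x w v.
Proof.
move=> vu vw uw nuw; rewrite /toward => h.
have := gp_nonadj vu vw uw nuw; have := gp_turn e_sym econn x vw; rewrite (tP vw).
have : gp e v u x <= gp e v u w \/ gp e v x w <= gp e v u w by exact: gp_ultra.
rewrite (gpC _ v u x) -!addnn in h *; lia.
Qed.

End Homogeneous.

(** * From two ends to an edge cut *)

Section Rays.
Variables (V : eqType) (e : rel V).
Hypothesis e_sym : symmetric e.

Definition ray (R : nat -> V) := injective R /\ forall n, e (R n) (R n.+1).

Lemma ray_avoid (R : nat -> V) (s : seq V) : injective R ->
  exists N, forall n, N <= n -> R n \notin s.
Proof.
move=> inj; elim: s => [|a s [N hN]]; first by exists 0.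
case: (lem (exists n, R n = a)) => [[n Rn]|na]; last first.
  exists N => m /hN; rewrite inE negb_or => ->; rewrite andbT.
  by apply/eqP => h; apply: na; exists m.
exists (maxn N n.+1) => m; rewrite geq_max => /andP[/hN ms nm].
rewrite inE negb_or ms andbT -Rn (inj_eq inj); lia.
Qed.

Lemma ray_path (R : nat -> V) n k : ray R -> path e (R n) [seq R i | i <- iota n.+1 k].
Proof.
move=> [_ Re]; elim: k n => //= k IHk n; by rewrite Re IHk.
Qed.

Lemma ray_last (R : nat -> V) n k : last (R n) [seq R i | i <- iota n.+1 k] = R (n + k).
Proof. by elim: k n => [|k IHk] n /=; rewrite ?addn0 // IHk addSnnS. Qed.

Definition avoiding (s : seq V) (x y : V) :=
  exists p, [/\ path e x p, last x p = y & all (fun z => z \notin s) (x :: p)].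

Lemma avoiding_sym s x y : avoiding s x y -> avoiding s y x.
Proof.
move=> [p [xp <- ap]]; exists (rev (belast x p)); split.
- by rewrite rev_path; apply: sub_path xp => u v; rewrite e_sym.
- by case: p {xp ap} => //= a p; rewrite rev_cons last_rcons.
- by rewrite -rev_rcons -lastI all_rev.
Qed.

Variable R : bool -> nat -> V.
Hypothesis Rray : forall i, ray (R i).

Record stage := Stage { trail : seq V; side : bool; pos : nat }.

(** The last clause keeps the ray beyond the current position unvisited, so that the trail can
    continue along it. *)
Definition good (S : stage) : Prop :=
  [/\ uniq (trail S), sorted e (trail S),
      exists W, trail S = rcons W (R (side S) (pos S)) &
      forall m, pos S < m -> R (side S) m \notin trail S].

(* The trail goes on along the ray it lies on, crosses to the other ray far away,
   and is cut off at the last vertex it shares with that ray. *)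
Lemma stage_step :
  (forall s N, exists n m, [/\ N <= n, N <= m & avoiding s (R true n) (R false m)]) ->
  forall S, exists S', good S -> good S' /\
    side S' = ~~ side S /\ exists2 U, U != [::] & trail S' = trail S ++ U.
Proof.
move=> av S; case: (lem (good S)) => [gS|nS]; last by exists S.
case: S gS => W i n [/= uW sW [W0 eW] tW].
have {}av s N j : exists n m, [/\ N <= n, N <= m & avoiding s (R j n) (R (~~ j) m)].
  have [k [m [Nk Nm a]]] := av s N; case: j; first by exists k, m.
  by exists m, k; split => //; exact: avoiding_sym.
have [N hN] := ray_avoid W (Rray (~~ i)).1.
have [k [m [nk nm [q [pq lq aq]]]]] := av W (maxn N n.+1) i.
pose U0 := [seq R i l | l <- iota n.+1 (k - n)] ++ q.
have pU0 : path e (R i n) U0.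
  by rewrite cat_path ray_path // ray_last subnKC // ltnW // (leq_trans _ nk) // leq_max leqnn orbT.
have lU0 : last (R i n) U0 = R (~~ i) m.
  by rewrite last_cat ray_last subnKC // ltnW // (leq_trans _ nk) // leq_max leqnn orbT.
have aU0 : forall z, z \in U0 -> z \notin W.
  move=> z; rewrite mem_cat => /orP[/mapP[l]|zq].
    by rewrite mem_iota => /andP[nl _] ->; exact: tW.
  by move/allP: aq; apply; rewrite inE zq orbT.
case: (shortenP pU0) lU0 => U1 pU1 uU1 sU1 lU1.
have Nm : N <= m by apply: leq_trans nm; rewrite leq_max leqnn.
have mU1 : R (~~ i) m \in U1.
  case: U1 lU1 {pU1 uU1 sU1} => [|a U1] /=; last by move <-; exact: mem_last.
  by move=> h; have := hN m Nm; rewrite -h eW mem_rcons mem_head.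
have [N' hN'] := ray_avoid U1 (Rray (~~ i)).1.
have exU1 : exists l, R (~~ i) l \in U1 by exists m.
have ubU1 l : R (~~ i) l \in U1 -> l <= N'.
  by move=> lU; rewrite leqNgt; apply/negP => /ltnW/hN'; rewrite lU.
case: (ex_maxnP exU1 ubU1) => l lU1' lmax.
have ml := lmax m mU1.
case/splitPr def_U1: {1}U1 / lU1' => [p1 p2].
pose U := rcons p1 (R (~~ i) l).
have UU1 z : z \in U -> z \in U1.
  by rewrite def_U1 -cat_rcons mem_cat => ->.
move: pU1 uU1; rewrite def_U1 -cat_rcons -/U cat_path cons_uniq cat_uniq.
move=> /andP[pU _] /and3P[_ uU _].
exists (Stage (W ++ U) (~~ i) l) => _; split; last first.
  by split => //=; exists U => //; rewrite /U; case: (p1).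
split=> /=.
- rewrite cat_uniq uW uU andbT; apply/hasPn => z /UU1/sU1; exact: aU0.
- rewrite eW; move: sW; rewrite eW; case: (W0) => //= w W1 sW1.
  by rewrite cat_path sW1 last_rcons.
- by exists (W ++ p1); rewrite /U rcons_cat.
- move=> l' ll'; rewrite mem_cat negb_or hN /=; last lia.
  by apply/negP => /UU1/lmax; lia.
Qed.

(** The trails extend one another and the [k]-th has more than [k] vertices, so their diagonal is a
    ray; the sides alternate, so it meets both rays infinitely often. *)
Lemma zigzag_ray :
  (forall s N, exists n m, [/\ N <= n, N <= m & avoiding s (R true n) (R false m)]) ->
  exists2 R3, ray R3 & forall i N, exists n m, N <= n /\ R3 n = R i m.
Proof.
move=> av; have [f fP] := choice (stage_step av).
pose S k := iter k f (Stage [:: R true 0] true 0).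
have gS k : good (S k).
  elim: k => [|k IHk]; last by have [] := fP _ IHk.
  split => //=; first by exists [::].
  move=> m m0; rewrite inE (inj_eq (Rray true).1); lia.
have next k : side (S k.+1) = ~~ side (S k) /\
    exists2 U, U != [::] & trail (S k.+1) = trail (S k) ++ U by have [] := fP _ (gS k).
have sz k : k < size (trail (S k)).
  elim: k => // k IHk; have [_ [U U0 ->]] := next k; rewrite size_cat.
  by case: U U0 => //= a U _; lia.
have prefix k j : exists U, trail (S (k + j)) = trail (S k) ++ U.
  elim: j => [|j [U EU]]; first by exists [::]; rewrite addn0 cats0.
  have [_ [U' _ EU']] := next (k + j).
  by exists (U ++ U'); rewrite addnS EU' EU catA.
pose x0 := R true 0; pose R3 k := nth x0 (trail (S k)) k.
have R3E k n : n < size (trail (S k)) -> R3 n = nth x0 (trail (S k)) n.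
  move=> nk; rewrite /R3; have [kn|kn] := leqP k n.
    by have [U] := prefix k (n - k); rewrite subnKC // => ->; rewrite nth_cat nk.
  by have [U] := prefix n (k - n); rewrite subnKC ?(ltnW kn) // => ->; rewrite nth_cat sz.
exists R3; first split.
- move=> n m; pose k := maxn n m.
  have szk j : j <= k -> j < size (trail (S k)) by move=> jk; exact: leq_ltn_trans (sz k).
  have nk : n < size (trail (S k)) by apply: szk; rewrite leq_maxl.
  have mk : m < size (trail (S k)) by apply: szk; rewrite leq_maxr.
  rewrite (R3E k) // (R3E k m) // => /eqP; rewrite nth_uniq //; first by move/eqP.
  by case: (gS k).
- move=> n; have n1 := sz n.+1; rewrite (R3E n.+1 n) ?(R3E n.+1 n.+1) //; last exact: ltnW.
  by have [_ /(sortedP x0) h _ _] := gS n.+1; apply: h.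
move=> i N.
have [k [Nk ik]] : exists k, N <= k /\ side (S k) = i.
  have [EN|EN] := eqVneq (side (S N)) i; first by exists N.
  exists N.+1; split => //; have [-> _] := next N.
  by move: EN; case: (side _); case: (i).
have [_ _ [W EW] _] := gS k; exists (size W), (pos (S k)).
have szW : size (trail (S k)) = (size W).+1 by rewrite EW size_rcons.
split; first by have := sz k; lia.
by rewrite (R3E k) ?szW // EW nth_rcons ltnn eqxx ik.
Qed.

(** Without a zigzag ray some finite [s] separates the tails of the two rays. The vertices reachable
    from one tail outside [s] form the cut; each boundary edge has an end in [s]. *)
Lemma sepcut_of_rays : (forall x, fin (fun y => e x y)) ->
  ~ (exists2 R3, ray R3 & forall i N, exists n m, N <= n /\ R3 n = R i m) ->
  exists C, sepcut e C.
Proof.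
move=> locfin nR.
have [s [N sN]] : exists s N, forall n m, N <= n -> N <= m -> ~ avoiding s (R true n) (R false m).
  apply: contrapT => h; apply/nR/zigzag_ray => s N; apply: contrapT => h'.
  by apply: h; exists s, N => n m Nn Nm a; apply: h'; exists n, m.
pose C y := `[< exists2 n, N <= n & avoiding s (R true n) y >].
exists C; split.
- move=> s'; have [N' hN'] := ray_avoid (s ++ s') (Rray true).1.
  have := hN' (maxn N N'); rewrite leq_maxr mem_cat negb_or => /(_ isT) /andP[ns ns'].
  exists (R true (maxn N N')) => //; apply/asboolP; exists (maxn N N'); first exact: leq_maxl.
  by exists [::]; rewrite /= ns.
- move=> s'; have [N' hN'] := ray_avoid s' (Rray false).1.
  exists (R false (maxn N N')); last by apply: hN'; exact: leq_maxr.
  by apply/asboolPn => -[n Nn]; apply: sN => //; exact: leq_maxl.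
have [nb nbP] := choice locfin.
pose L := [seq (y, x) | x <- s, y <- nb x] ++ [seq (x, y) | x <- s, y <- nb x].
have step x y : e x y -> C x -> ~~ C y -> y \in s.
  move=> xy /asboolP[n Nn [p [pp lp ap]]] /asboolPn nCy; apply/negPn/negP => ys.
  apply: nCy; exists n => //; exists (rcons p y); split.
  - by rewrite rcons_path pp lp.
  - by rewrite last_rcons.
  - by rewrite -rcons_cons all_rcons ys ap.
exists L => -[x y] [/= xy ne]; rewrite mem_cat; case Cx: (C x) ne; case Cy: (C y) => // _.
  have ys := step x y xy Cx (negbT Cy); apply/orP; left; apply/allpairsPdep; exists y, x.
  by split => //; apply: nbP; rewrite e_sym.
have xs : x \in s by apply: (step y x); rewrite ?Cx // e_sym.
by apply/orP; right; apply/allpairsPdep; exists x, y; split => //; exact: nbP.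
Qed.

End Rays.

(** * Coordinates in T(r) *)

Lemma reduced_mul_gen r (i : 'I_r) w : reduced w -> reduced (mul_gen i w).
Proof.
case: w => [//|[j b] w] /= red; have [ji|ji] := eqVneq j i.
  by case: b red; [rewrite -ji; case: w | exact: path_sorted].
by rewrite /reduced /= eq_sym ji.
Qed.

Section Coordinates.
Variables (V : eqType) (arc : rel V) (r : nat) (o : V -> 'I_r -> V) (nx : V -> V -> V).
Variables (x0 : V) (tw : V -> V -> Prop).
Local Notation e := (uadj arc).
Hypotheses (asym : forall x y, arc x y -> arc y x = false)
  (econn : conn e xpredT)
  (o_inj : forall x, injective (o x))
  (oP : forall x y, arc x y <-> exists i, o x i = y)
  (nxl : forall x y, arc x y -> arc y (nx x y))
  (nxr : forall x y, arc x y -> arc (nx x y) x)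
  (nxU : forall x y w, arc x y -> e x w -> e y w -> w = nx x y).
(** [tw v u] makes [u] the parent of [v] on the way back to [x0]; these properties are all that is
    kept of the structure tree. *)
Hypotheses (tw_irr : forall u, ~ tw x0 u)
  (tw0 : forall u, e x0 u -> tw u x0)
  (tw_uniq : forall v u u', e v u -> e v u' -> tw v u -> tw v u' -> u = u')
  (tw_step : forall v u w, e v u -> e v w -> u != w -> ~~ e u w -> tw v u -> tw w v).

(** A transposition of labels gives [n] the label [i]; if [n] is no out-neighbour, the labelling
    stays as it is. *)
Definition relabel v (i : 'I_r) n : 'I_r -> V :=
  fun j => if [pick k | o v k == n] is Some k then o v (tperm i k j) else o v j.

Lemma relabel_inj v i n : injective (relabel v i n).
Proof. by rewrite /relabel; case: pickP => [k _|_] j j' /o_inj // /perm_inj. Qed.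

Lemma relabelP v i n y : arc v y <-> exists j, relabel v i n j = y.
Proof.
rewrite oP /relabel; case: pickP => [k _|_] //; split=> -[j <-]; last by eexists.
by exists (tperm i k j); rewrite tpermK.
Qed.

Lemma relabel_at v i n : arc v n -> relabel v i n i = n.
Proof.
move=> /oP[k vk]; rewrite /relabel; case: pickP => [l /eqP <-|/(_ k)]; last by rewrite vk eqxx.
by rewrite tpermL.
Qed.

(* The vertex reached by a word, with a labelling of the arcs leaving it by the
   generators in which the triangle just traversed keeps its label. *)
Fixpoint locate (w : seq (letter r)) : V * ('I_r -> V) :=
  match w with
  | [::] => (x0, o x0)
  | (i, b) :: w' =>
      let: (u, f) := locate w' in
      let v := f i in
      if b then (v, relabel v i (nx u v)) else (nx u v, relabel (nx u v) i u)
  end.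

Definition vert w := (locate w).1.
Definition out w := (locate w).2.

Lemma vert_cons i b w : vert ((i, b) :: w) = if b then out w i else nx (vert w) (out w i).
Proof. by rewrite /vert /out /=; case: (locate w) => u f; case: b. Qed.

Lemma out_cons i b w : out ((i, b) :: w) =
  if b then relabel (out w i) i (nx (vert w) (out w i))
  else relabel (nx (vert w) (out w i)) i (vert w).
Proof. by rewrite /vert /out /=; case: (locate w) => u f; case: b. Qed.

Lemma out_inj w : injective (out w).
Proof.
by case: w => [|[i []] w]; rewrite ?out_cons; do [exact: o_inj | exact: relabel_inj].
Qed.

Lemma outP w y : arc (vert w) y <-> exists i, out w i = y.
Proof.
by case: w => [|[i []] w]; rewrite ?out_cons ?vert_cons; do [exact: oP | exact: relabelP].
Qed.

Lemma arc_out w i : arc (vert w) (out w i).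
Proof. by apply/outP; exists i. Qed.

(** The relation a_i^3 = 1: repeating the label [i] goes round the triangle. *)
Lemma out_back i b w : out ((i, b) :: w) i = if b then nx (vert w) (out w i) else vert w.
Proof.
by rewrite out_cons; case: b; apply: relabel_at; [apply: nxl|apply: nxr]; exact: arc_out.
Qed.

Lemma vert_mul_gen i w : vert (mul_gen i w) = out w i.
Proof.
case: w => [|[j b] w]; first by rewrite vert_cons.
rewrite /mul_gen; have [->|ji] := eqVneq j i; last by rewrite vert_cons.
by rewrite out_back; case: b; rewrite ?vert_cons.
Qed.

Lemma common_uniq p q w w' : e p q -> e p w -> e q w -> e p w' -> e q w' -> w = w'.
Proof.
move=> /orP[pq|qp] pw qw pw' qw'; first by rewrite (nxU pq pw qw) (nxU pq pw' qw').
by rewrite (nxU qp qw pw) (nxU qp qw' pw').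
Qed.

(** An edge has only one common neighbour, so triangles on different arcs leaving [x] neither meet
    nor are joined away from [x]. *)
Lemma same_triangle x a b u v : arc x a -> arc x b ->
  u = a \/ u = nx x a -> v = b \/ v = nx x b -> u = v \/ e u v -> a = b.
Proof.
move=> xa xb hu hv uv.
have [ax xa'] : e x a /\ e a x by rewrite /uadj xa orbT.
have [bx xb'] : e x b /\ e b x by rewrite /uadj xb orbT.
have [ea1 ea2] : e (nx x a) a /\ e x (nx x a) by rewrite /uadj nxl ?nxr ?orbT.
have [eb1 eb2] : e (nx x b) b /\ e x (nx x b) by rewrite /uadj nxl ?nxr ?orbT.
have na b' : arc x b' -> b' <> nx x a by move=> /asym + h; rewrite h nxr.
have nb b' : arc x b' -> b' <> nx x b by move=> /asym + h; rewrite h nxr.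
case: hu hv uv => -> [] -> [] // h.
- by case: (na b xb); exact: nxU.
- by case: (nb a xa).
- by apply: (@common_uniq x (nx x b)) => //; rewrite uadjC.
- by case: (na b xb).
- by apply: (@common_uniq x (nx x a)).
- by apply: (@common_uniq x (nx x a)) => //; rewrite h.
- by case: (nb a xa); apply: (@common_uniq x (nx x a)).
Qed.

Lemma vert_adj l w : e (vert w) (vert (l :: w)).
Proof.
by case: l => i [] ; rewrite vert_cons /uadj ?arc_out // nxr ?orbT //; exact: arc_out.
Qed.

Lemma vert_in i b w : vert ((i, b) :: w) = out w i \/ vert ((i, b) :: w) = nx (vert w) (out w i).
Proof. by case: b; rewrite vert_cons; [left | right]. Qed.

Lemma vert_parent i b w (v := vert ((i, b) :: w)) (a := out ((i, b) :: w) i) :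
  vert w = a \/ vert w = nx v a.
Proof.
rewrite {}/v {}/a out_back; case: b; [right | by left].
have xa := arc_out w i; rewrite vert_cons; apply: nxU; first exact: nxl.
  by rewrite /uadj xa orbT.
by rewrite /uadj nxr.
Qed.

(** Consecutive letters of a reduced word have different indices, so the walk changes triangles and
    [tw_step] applies. *)
Lemma tw_parent l w : reduced (l :: w) -> tw (vert (l :: w)) (vert w).
Proof.
elim: w l => [|[j c] w IHw] l red; first by apply: tw0; exact: (vert_adj l [::]).
have tww := IHw (j, c) (path_sorted red).
have ne : ~ (vert w = vert (l :: (j, c) :: w) \/ e (vert w) (vert (l :: (j, c) :: w))).
  case: l red => i b /= red.
  move/(same_triangle (arc_out ((j, c) :: w) j) (arc_out ((j, c) :: w) i)
    (vert_parent j c w) (vert_in i b _)) => /out_inj ji.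
  by move: red; rewrite /reduced /= ji eqxx.
apply: tw_step tww.
- by rewrite uadjC vert_adj.
- exact: vert_adj.
- by apply/eqP => h; apply: ne; left.
- by apply/negP => h; apply: ne; right.
Qed.

(** Unique parents give equal words up to the last letter; the triangle then gives its index, and
    the orientation its exponent. *)
Lemma vert_inj w1 w2 : reduced w1 -> reduced w2 -> vert w1 = vert w2 -> w1 = w2.
Proof.
elim: w1 w2 => [|l1 w1 IHw] [|l2 w2] // red1 red2 E.
- by case: (@tw_irr (vert w2)); have := tw_parent red2; rewrite -E.
- by case: (@tw_irr (vert w1)); have := tw_parent red1; rewrite E.
have Ew : w1 = w2.
  apply: IHw (path_sorted red1) (path_sorted red2) _.
  apply: (@tw_uniq (vert (l1 :: w1))).
  - by rewrite uadjC vert_adj.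
  - by rewrite E uadjC vert_adj.
  - exact: tw_parent.
  - by rewrite E; exact: tw_parent.
subst w2; congr cons; case: l1 l2 E {red1 red2} => i b [j c] E.
have ij : i = j.
  apply: (@out_inj w1); apply: (same_triangle (arc_out w1 i) (arc_out w1 j)
    (vert_in i b w1) (vert_in j c w1)); by left.
subst j; congr pair; move: E; rewrite !vert_cons.
have := nxr (arc_out w1 i); have := asym (arc_out w1 i).
by case: b; case: c => // h1 h2 h; move: h2; [rewrite -h h1 | rewrite h h1].
Qed.

Lemma vert_surj y : exists2 w, reduced w & vert w = y.
Proof.
apply: (econn (A := fun y => exists2 w, reduced w & vert w = y) (x := x0)) => //.
  by exists [::].
move=> u v _ _ uv [w rw wu].
have go w' z : reduced w' -> arc (vert w') z -> exists2 w'', reduced w'' & vert w'' = z.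
  by move=> rw' /outP[i <-]; exists (mul_gen i w'); rewrite ?reduced_mul_gen ?vert_mul_gen.
case/orP: uv => [uv|vu]; first by apply: (go w); rewrite ?wu.
(* An arc is traversed backwards by going forward twice round its triangle. *)
have [w' rw' w'z] : exists2 w', reduced w' & vert w' = nx v u.
  by apply: (go w); rewrite // wu; exact: nxl.
by apply: (go w') => //; rewrite w'z; exact: nxr.
Qed.

Lemma coordinates_iso : exists phi : V -> Tvert r,
  bijective phi /\ forall x y, arc x y <-> Tarc (phi x) (phi y).
Proof.
have surj y : exists w : Tvert r, vert (val w) = y.
  by have [w rw wy] := vert_surj y; exists (Sub w rw).
have [phi phiP] := choice surj.
have phiK (w : Tvert r) : phi (vert (val w)) = w.
  by apply/val_inj/vert_inj; rewrite ?phiP //; exact: valP.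
exists phi; split; first by exists (fun w => vert (val w)).
move=> x y; split.
  rewrite -{1}(phiP x) => /outP[i xy]; exists i; apply: vert_inj.
  - exact: valP.
  - by apply: reduced_mul_gen; exact: valP.
  - by rewrite vert_mul_gen xy phiP.
move=> [i E]; rewrite -(phiP x) -(phiP y) E vert_mul_gen; exact: arc_out.
Qed.

End Coordinates.

(** * T(r) is connected-homogeneous *)

Section FreeProduct.
Variable r : nat.
Implicit Types (i j : 'I_r) (l : letter r) (u v w : seq (letter r)).

Definition tarc : rel (Tvert r) := fun x y => [exists i, val y == mul_gen i (val x)].

Lemma tarcP (x y : Tvert r) : reflect (Tarc x y) (tarc x y).
Proof. by apply: (iffP existsP) => -[i /eqP]; exists i => //; apply/eqP. Qed.

Lemma mul_gen_fresh i b w : reduced ((i, b) :: w) -> mul_gen i w = (i, true) :: w.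
Proof. by case: w => [//|[j c] w] /= /andP[/= ij _]; rewrite eq_sym (negbTE ij). Qed.

Lemma mul_gen3 i w : reduced w -> mul_gen i (mul_gen i (mul_gen i w)) = w.
Proof.
case: w => [|[j b] w] red; first by rewrite /= eqxx /= eqxx.
rewrite [mul_gen i (_ :: _)]/=; have [ji|ji] := eqVneq j i; last by rewrite /= eqxx /= eqxx.
subst j; case: b red => red /=; first by rewrite eqxx (mul_gen_fresh red).
by rewrite (mul_gen_fresh red) /= eqxx.
Qed.

Definition mul_letter l w := if l.2 then mul_gen l.1 w else mul_gen l.1 (mul_gen l.1 w).

(** The group product [u w]: words are reversed, so folding from the right applies the first letter
    of [w] first. *)
Definition lmul u w := foldr mul_letter u w.

Lemma reduced_lmul u w : reduced u -> reduced (lmul u w).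
Proof.
move=> ru; elim: w => //= l w IHw; rewrite /mul_letter.
by case: l.2; rewrite !reduced_mul_gen.
Qed.

Lemma lmul_mul_gen u i w : reduced u -> lmul u (mul_gen i w) = mul_gen i (lmul u w).
Proof.
move=> ru; case: w => [//|[j b] w] /=; have [->|//] := eqVneq j i.
by case: b => //=; rewrite /mul_letter /= mul_gen3 // reduced_lmul.
Qed.

Lemma lmul0 w : reduced w -> lmul [::] w = w.
Proof.
elim: w => //= -[i b] w IHw red; rewrite (IHw (path_sorted red)) /mul_letter /=.
by rewrite (mul_gen_fresh red); case: b red; rewrite /= ?eqxx.
Qed.

Lemma lmulA v u w : reduced v -> lmul v (lmul u w) = lmul (lmul v u) w.
Proof.
by move=> rv; elim: w => //= l w <-; rewrite /mul_letter; case: l.2; rewrite !lmul_mul_gen.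
Qed.

Lemma lmulV u : reduced u -> exists2 v, reduced v & lmul v u = [::].
Proof.
elim: u => [|[i b] u IHu] red; first by exists [::].
have [v rv vu] := IHu (path_sorted red).
exists (lmul [:: (i, ~~ b)] v); first by rewrite reduced_lmul.
have E : lmul v ((i, b) :: u) = mul_letter (i, b) [::] by rewrite -vu.
rewrite -lmulA // E; case: b {red E}; rewrite /mul_letter /=.
  by rewrite /mul_letter /= eqxx.
by rewrite eqxx /lmul /= /mul_letter /= !eqxx /= ?eqxx.
Qed.

Definition translate (x y : Tvert r) : Tvert r :=
  Sub (lmul (val x) (val y)) (reduced_lmul (val y) (valP x)).

Lemma tarc_translate (z x y : Tvert r) : tarc x y -> tarc (translate z x) (translate z y).
Proof.
case/existsP => i /eqP E; apply/existsP; exists i => /=.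
by rewrite E lmul_mul_gen // (valP z).
Qed.

Lemma aut_hom (g h : Tvert r -> Tvert r) : cancel g h -> cancel h g ->
  {homo g : x y / tarc x y} -> {homo h : x y / tarc x y} -> aut tarc g.
Proof.
move=> gK hK gh hh; split; first by exists h.
by move=> x y; apply/idP/idP => [/hh|/gh //]; rewrite !gK.
Qed.

Lemma translate_linv (x : Tvert r) : exists y, cancel (translate x) (translate y).
Proof.
have [v rv vx] := lmulV (valP x); exists (Sub v rv) => w; apply: val_inj => /=.
by rewrite lmulA // vx lmul0 // (valP w).
Qed.

Lemma translate_aut (x : Tvert r) : aut tarc (translate x).
Proof.
have [v uv] := translate_linv x; have [v' vv'] := translate_linv v.
have vu : cancel (translate v) (translate x).
  by move=> w; rewrite -[LHS]vv' uv vv'.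
by apply: aut_hom uv vu _ _ => y z; exact: tarc_translate.
Qed.

Lemma to_identity (c : Tvert r) : exists2 g, aut tarc g & val (g c) = [::].
Proof.
have [v rv vc] := lmulV (valP c); exists (translate (Sub v rv)) => //; exact: translate_aut.
Qed.

(** The first letter, last in the reversed list, determines the branch at the identity. *)
Definition first_index w : option 'I_r := if w is l :: w' then Some (last l w').1 else None.

(** * Swapping two branches at the identity *)

Section Swap.
Variables (i j : 'I_r).

Definition swap_letter l : letter r := (tperm i j l.1, l.2).

Definition branches w := first_index w \in [:: Some i; Some j].

(** Relabelling all letters, and not only the first, keeps the word reduced. *)
Definition swap w := if branches w then map swap_letter w else w.

Lemma branches_swap w : branches (map swap_letter w) = branches w.
Proof.
case: w => //= l w; rewrite /branches /= last_map !inE !(inj_eq Some_inj) /=.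
by case: tpermP => [->|->|]; rewrite ?eqxx ?orbT //; rewrite eq_sym.
Qed.

Lemma swapK : involutive swap.
Proof.
move=> w; rewrite {2}/swap; case bw: (branches w); last by rewrite /swap bw.
rewrite /swap branches_swap bw -map_comp map_id_in // => -[k b] _ /=.
by rewrite /swap_letter /= tpermK.
Qed.

Lemma reduced_swap w : reduced w -> reduced (swap w).
Proof.
rewrite /swap; case: branches => // red.
rewrite /reduced sorted_map; apply: sub_sorted red => a b /=.
by rewrite (inj_eq perm_inj).
Qed.

Lemma mul_gen_map k w :
  mul_gen (tperm i j k) (map swap_letter w) = map swap_letter (mul_gen k w).
Proof.
case: w => [//|[m b] w] /=; rewrite (inj_eq perm_inj).
by case: eqP => // _; case: b.
Qed.

Lemma branches_mul_gen k l w :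
  mul_gen k (l :: w) = [::] \/ branches (mul_gen k (l :: w)) = branches (l :: w).
Proof.
rewrite /branches; case: l => m b /=; case: eqP => [->|_]; last by right.
by case: b; [case: w => [|a w]; right | case: w => [|a w]; [left|right]].
Qed.

(** A branch is left only through the identity. The label may vary with [w], since [Tarc] forgets
    labels. *)
Lemma swap_mul_gen k w : exists k', swap (mul_gen k w) = mul_gen k' (swap w).
Proof.
case: w => [|l w].
  rewrite /swap /=; case: branches; [by exists (tperm i j k) | by exists k].
have := branches_mul_gen k l w; set w' := l :: w => h.
case bw: (branches w') h => h.
  exists (tperm i j k); rewrite [swap w']/swap bw mul_gen_map.
  by case: h => h; rewrite /swap h.
exists k; rewrite [swap w']/swap bw; by case: h => h; rewrite /swap h.
Qed.

Definition swap_vert (x : Tvert r) : Tvert r := Sub (swap (val x)) (reduced_swap (valP x)).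

Lemma swap_vert_aut : aut tarc swap_vert.
Proof.
have K : involutive swap_vert by move=> x; apply: val_inj; rewrite /= swapK.
have hm : {homo swap_vert : x y / tarc x y}.
  move=> x y /existsP[k /eqP E]; have [k' E'] := swap_mul_gen k (val x).
  by apply/existsP; exists k' => /=; rewrite E E'.
exact: (aut_hom K K hm hm).
Qed.

End Swap.

Lemma aut_comp (g h : Tvert r -> Tvert r) : aut tarc g -> aut tarc h -> aut tarc (g \o h).
Proof.
move=> [bg ag] [bh ah]; split; first exact: bij_comp.
by move=> x y /=; rewrite ag ah.
Qed.

Lemma aut_inv (g h : Tvert r -> Tvert r) : aut tarc g -> cancel g h -> cancel h g -> aut tarc h.
Proof. by move=> [_ ag] gK hK; split; [exists g | move=> x y; rewrite -ag !hK]. Qed.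

(** [z] completes the triangle of [x] and the identity, so it is adjacent to [x] but not to [y]. *)
Lemma branch_separated i j b (x y z : Tvert r) : i != j ->
  val x = [:: (i, b)] -> val y = [:: (j, b)] -> val z = [:: (i, ~~ b)] ->
  tarc x z = tarc y z -> tarc z x = tarc z y -> False.
Proof.
move=> ij Ex Ey Ez h1 h2; case: b Ex Ey Ez => Ex Ey Ez.
  have : tarc x z by apply/existsP; exists i; rewrite Ex Ez /= eqxx.
  rewrite h1 => /existsP[k /eqP]; rewrite Ey Ez /=.
  by case: eqP => // <- [] /eqP; rewrite (negbTE ij).
have : tarc z x by apply/existsP; exists i; rewrite Ex Ez /= eqxx.
rewrite h2 => /existsP[k /eqP]; rewrite Ey Ez /=.
by case: eqP => // <- [] /eqP; rewrite eq_sym (negbTE ij).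
Qed.

Lemma neighbour_of_identity (c a : Tvert r) : val c = [::] -> uadj tarc c a ->
  exists i, val a = [:: (i, tarc c a)].
Proof.
move=> Ec; rewrite /uadj; case ca: (tarc c a) => /=.
  by move=> _; case/existsP: ca => i /eqP ->; exists i; rewrite Ec.
case/existsP => i /eqP; rewrite Ec; case Ea: (val a) => [|[j b] w] //=.
by case: eqP => // ji; case: b Ea => // Ea E; exists i; rewrite [LHS]Ea -E ji.
Qed.

(* Move [c] to the identity; [a] and [b] lie in different branches there, the set
   [s] meets neither branch, and swapping the two branches does the job. *)
Lemma fixing_aut (s : seq (Tvert r)) c a b :
  conn (uadj tarc) (fun x => x \in s) -> c \in s -> a \notin s -> b \notin s ->
  uadj tarc c a ->
  (forall y, y \in s -> tarc y a = tarc y b /\ tarc a y = tarc b y) ->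
  exists2 k, aut tarc k & (forall y, y \in s -> k y = y) /\ k a = b.
Proof.
move=> cs cS aS bS ca ab; have [<-|neab] := eqVneq a b.
  by exists id => //; split => //; exists id.
have [g ga gc] := to_identity c; have [[h gK hK] _] := ga.
have [E1 E2] := ab c cS.
have cb : uadj tarc c b by rewrite /uadj -E1 -E2.
have [i Ei] : exists i, val (g a) = [:: (i, tarc c a)].
  by have := @neighbour_of_identity (g c) (g a) gc; rewrite (aut_uadj ga) ga.2; apply.
have [j Ej] : exists j, val (g b) = [:: (j, tarc c a)].
  by have := @neighbour_of_identity (g c) (g b) gc; rewrite (aut_uadj ga) ga.2 -E1; apply.
have ij : i != j.
  apply: contra neab => /eqP ij; rewrite -(inj_eq (can_inj gK)); apply/eqP/val_inj.
  by rewrite Ei Ej ij.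
exists (h \o swap_vert i j \o g).
  apply: (aut_comp _ ga); apply: aut_comp; last exact: swap_vert_aut.
  exact: (aut_inv ga gK hK).
split; last first.
  rewrite /= -[b]gK; congr h; apply: val_inj; rewrite /= Ei Ej /swap /branches /= inE eqxx.
  by rewrite /swap_letter /= tpermL.
(* An edge entering the branches goes from the identity to [g a], [g b] or the third vertex of one
   of their triangles; the first two are not images of [s], and the third would distinguish [a] from
   [b]. *)
have nb y : y \in s -> ~~ branches i j (val (g y)).
  move: y; apply: (cs (fun y => ~~ branches i j (val (g y))) c) => //; first by rewrite gc.
  move=> u v us vs uv nu; apply/negP => bv.
  have [gu [q [d [gv qij]]]] : val (g u) = [::] /\
      exists (q : 'I_r) d, val (g v) = [:: (q, d)] /\ (q = i \/ q = j).
    have qij (q : 'I_r) d : branches i j [:: (q, d)] -> q = i \/ q = j.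
      by rewrite /branches /= !inE => /orP[/eqP[->]|/eqP[->]]; [left|right].
    move: uv; rewrite -(aut_uadj ga) => /orP[] /existsP[k /eqP].
      case: (val (g u)) nu => [|m w] nu E.
        by rewrite E in bv *; split => //; exists k, true; split => //; exact: (qij k true).
      by case: (branches_mul_gen i j k m w); rewrite -E => E'; move: bv; rewrite E' // (negbTE nu).
    case: (val (g v)) bv => [//|m w] bv E.
    case: (branches_mul_gen i j k m w); rewrite -E => E'; last by move: nu; rewrite E' bv.
    split => //; move: E bv; rewrite E'; case: m => m d /=; case: eqP => // ->.
    by case: d => // <- /qij ?; exists k, false.
  have neq z : z \notin s -> val (g v) <> val (g z).
    by move=> zs /val_inj/(can_inj gK) vz; rewrite vz (negbTE zs) in vs.
  have [Ev1 Ev2] := ab v vs.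
  have [dE|dE] := eqVneq d (tarc c a).
    by case: qij => lE; [case: (neq a aS) | case: (neq b bS)]; rewrite gv ?Ei ?Ej lE dE.
  have {}dE : d = ~~ tarc c a by move: dE; case: (d); case: (tarc c a).
  case: qij => lE; rewrite lE dE in gv.
    by apply: (branch_separated ij Ei Ej gv); rewrite !ga.2.
  by rewrite eq_sym in ij; apply: (branch_separated ij Ej Ei gv); rewrite !ga.2.
by move=> y /nb ny; rewrite -[RHS]gK; congr h; apply: val_inj; rewrite /= /swap (negbTE ny).
Qed.

Lemma tvert_trans (x y : Tvert r) : exists2 g, aut tarc g & g x = y.
Proof.
have [g ga gx] := to_identity x; have [h ha hy] := to_identity y.
have [[h' hK h'K] _] := ha.
exists (h' \o g); first by apply: (aut_comp _ ga); exact: (aut_inv ha hK h'K).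
by rewrite /= -[y]hK; congr h'; apply: val_inj; rewrite gx hy.
Qed.

(** If [g] agrees with [f] on a connected [s], then [a] and the [g]-preimage of [f a] have the same
    arcs to [s]. An automorphism [k] fixing [s] takes one to the other, and [g \o k] agrees with [f]
    on [a] as well. *)
Lemma T_homogeneous (A : Tvert r -> Prop) (f : Tvert r -> Tvert r) (x0 : Tvert r) :
  fin A -> A x0 ->
  (forall (Q : Tvert r -> Prop), Q x0 ->
    (forall x y, A x -> A y -> uadj tarc x y -> Q x -> Q y) -> forall y, A y -> Q y) ->
  (forall x y, A x -> A y -> f x = f y -> x = y) ->
  (forall x y, A x -> A y -> tarc x y = tarc (f x) (f y)) ->
  exists2 g, aut tarc g & forall x, A x -> g x = f x.
Proof.
move=> fA A0 cA fI fE.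
have main n (s : seq (Tvert r)) : ncard (fun x => A x /\ x \notin s) <= n -> x0 \in s ->
    (forall x, x \in s -> A x) -> conn (uadj tarc) (fun x => x \in s) ->
    (exists2 g, aut tarc g & forall x, x \in s -> g x = f x) ->
    exists2 g, aut tarc g & forall x, A x -> g x = f x.
  elim: n s => [|n IHn] s.
    rewrite leqn0 => /eqP N0 _ _ _ [g ga gf]; exists g => // x Ax; apply: gf.
    apply/negPn/negP => xs; have : 0 < ncard (fun x => A x /\ x \notin s); last by rewrite N0.
    by apply: (ncard_gt0 (z := x)) => //; apply: fin_sub fA _ => y [].
  move=> Nn s0 sA cs [g ga gf].
  case: (lem (exists c a, [/\ c \in s, A a, a \notin s & uadj tarc c a])) => [|no]; last first.
    exists g => // x Ax; apply: gf; apply: (cA (fun x => x \in s)) => // u v Au Av uv us.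
    by apply/negPn/negP => vs; apply: no; exists u, v.
  move=> [c [a [cS Aa aS ca]]]; have [[h gK hK] _] := ga.
  have ha := aut_inv ga gK hK.
  have hf y : y \in s -> h (f y) = y by move=> ys; rewrite -gf.
  have [] // := @fixing_aut s c a (h (f a)).
  - apply/negP => bs; have := gf _ bs; rewrite hK => /fI E.
    by move: aS; rewrite E ?bs //; exact: sA.
  - move=> y ys; have Ay := sA _ ys.
    by rewrite -{2 4}(hf y ys) !ha.2 -!fE.
  move=> k ka [ks kab]; apply: (IHn (a :: s)).
  - rewrite -ltnS; apply: leq_trans Nn; apply: (ncard_lt (z := a)) => //.
    + by apply: fin_sub fA _ => y [].
    + by move=> y [Ay]; rewrite inE negb_or => /andP[].
    + by case=> _; rewrite inE eqxx.
  - by rewrite inE s0 orbT.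
  - by move=> y; rewrite inE => /orP[/eqP->|/sA].
  - move=> Q x xs Qx cl.
    have cl' y z : y \in s -> z \in s -> uadj tarc y z -> Q y -> Q z.
      by move=> ys zs; apply: cl; rewrite inE ?ys ?zs orbT.
    have aS' : a \in a :: s by rewrite mem_head.
    have cS' : c \in a :: s by rewrite inE cS orbT.
    have Qc : Q c.
      move: xs; rewrite inE => /orP[/eqP xa|xs]; last exact: (cs Q x).
      by apply: (cl a c) => //; rewrite -?xa // uadjC -?xa // xa.
    move=> y; rewrite inE => /orP[/eqP->|ys]; first exact: (cl c a).
    exact: (cs Q c).
  - exists (g \o k); first exact: aut_comp.
    by move=> y; rewrite inE => /orP[/eqP->|ys]; rewrite /= ?kab ?hK ?ks ?gf.
apply: (main (ncard (fun x => A x /\ x \notin [:: x0])) [:: x0]) => //.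
- by rewrite mem_head.
- by move=> x; rewrite inE => /eqP ->.
- by move=> Q u; rewrite inE => /eqP -> Q0 _ y; rewrite inE => /eqP ->.
have [g ga gx] := tvert_trans x0 (f x0); exists g => // x; rewrite inE => /eqP ->; exact: gx.
Qed.

End FreeProduct.

(** * From propositional to boolean digraphs *)

Lemma In_mem (T : eqType) (x : T) (l : seq T) : List.In x l <-> x \in l.
Proof.
elim: l => [|a l IHl] //=; rewrite inE IHl; split.
  by case=> [->|->]; rewrite ?eqxx ?orbT.
by case/orP => [/eqP->|]; [left | right].
Qed.

Lemma upath_ind_on (V : Type) (arc : V -> V -> Prop) (A Q : V -> Prop) x y :
  upath arc A x y ->
  (forall u v, A u -> A v -> adj arc u v -> Q u -> Q v) -> Q x -> Q y.
Proof.
move=> p cl; elim: p => // {}x {}y z Ax xy p IH Qx; apply: IH; apply: (cl x) => //.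
by case: p.
Qed.

Section Forward.
Variables (V : eqType) (arc : V -> V -> Prop).
Hypotheses (dig : is_digraph arc) (con : connected arc) (loc : locally_finite arc)
  (ends : more_than_one_end arc) (tri : embeds_triangle arc) (hom : conn_homogeneous arc).

Let a : rel V := fun x y => `[< arc x y >].
Local Notation e := (uadj a).

Let adjP x y : reflect (adj arc x y) (e x y).
Proof. exact: or_asboolP. Qed.

Let irr x : a x x = false. Proof. by apply: asboolF; case: dig. Qed.

Let asym x y : a x y -> a y x = false.
Proof. by move=> /asboolP xy; apply: asboolF; case: dig => _; apply. Qed.

Let econn : conn e xpredT.
Proof.
move=> A x _ Ax cl y _; apply: (upath_ind_on (con (x := x) (y := y) I I)) Ax => u v _ _ uv.
by apply: cl => //; apply/adjP.
Qed.

Let locfin x : fin (fun y => e x y).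
Proof.
case: (loc x) => -[l1 h1] [l2 h2]; exists (l1 ++ l2) => y /adjP xy; rewrite mem_cat.
by apply/orP; case: xy => [/h1|/h2] /In_mem; [left | right].
Qed.

Let automorphism_aut g : automorphism arc g -> aut a g.
Proof.
by move=> [bg ag]; split => // x y; apply: asbool_equiv_eq; case: (ag x y).
Qed.

Let vtrans x y : exists2 g, aut a g & g x = y.
Proof.
have [||||||g [ga gx]] := @hom (fun z => z = x) (fun z => z = y) (fun=> y).
- by exists [:: x] => z ->; left.
- by move=> u v -> ->; apply: upath_refl.
- by [].
- by move=> u v -> ->.
- by move=> z ->; exists x.
- by move=> u v -> ->; split=> h; case: dig => /(_ _ h).
by exists g; [exact: automorphism_aut | exact: gx].
Qed.

Let star2 x y z x' y' z' :
  e x y -> e x z -> e x' y' -> e x' z' -> a x y = a x' y' -> a x z = a x' z' ->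
  (y == z) = (y' == z') -> a y z = a y' z' -> a z y = a z' y' ->
  exists2 g, aut a g & [/\ g x = x', g y = y' & g z = z'].
Proof.
move=> xy xz xy' xz' Exy Exz Eyz Ayz Azy.
have ne u v : e u v -> (u == v) = false.
  by move=> uv; apply/eqP => E; move: uv; rewrite E /uadj irr.
have back u v u' v' : e u v -> e u' v' -> a u v = a u' v' -> a v u = a v' u'.
  rewrite /uadj; case uv: (a u v) => /= h h' E; rewrite -E in h'.
    by rewrite (asym uv) asym // -E.
  by rewrite h; move: h' => /= ->.
have Eyx := back _ _ _ _ xy xy' Exy; have Ezx := back _ _ _ _ xz xz' Exz.
pose f w := if w == x then x' else if w == y then y' else z'.
have fx : f x = x' by rewrite /f eqxx.
have fy : f y = y' by rewrite /f eq_sym (ne _ _ xy) eqxx.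
have fz : f z = z'.
  rewrite /f eq_sym (ne _ _ xz) eq_sym Eyz; by case: eqP.
pose A w := [\/ w = x, w = y | w = z].
have Ax : A x by apply: Or31.
have Ay : A y by apply: Or32.
have Az : A z by apply: Or33.
have conA u v : A u -> A v -> upath arc A u v.
  move=> Au Av; have xv : upath arc A x v.
    have up w : A w -> e x w -> upath arc A x w.
      by move=> Aw /adjP xw; apply: upath_step xw (upath_refl _ Aw).
    by case: Av => ->; [exact: upath_refl | exact: up | exact: up].
  have go w : A w -> e x w -> upath arc A w v.
    by move=> Aw; rewrite uadjC => /adjP wx; apply: upath_step wx xv.
  by case: Au => -> //; exact: go.
have fI u v : A u -> A v -> (f u == f v) = (u == v).
  have [n1 n2 n3 n4] := And4 (ne _ _ xy) (ne _ _ xz) (ne _ _ xy') (ne _ _ xz').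
  case=> -> []->; rewrite ?fx ?fy ?fz ?eqxx ?n1 ?n2 ?n3 ?n4 //.
  - by rewrite eq_sym n3 eq_sym n1.
  - by rewrite eq_sym n4 eq_sym n2.
  - by rewrite eq_sym -Eyz eq_sym.
have fA u v : A u -> A v -> a (f u) (f v) = a u v.
  by case=> -> []->; rewrite ?fx ?fy ?fz ?irr.
have [||||||g [ga gf]] := @hom A (fun w => exists2 u, A u & f u = w) f.
- by exists [:: x; y; z] => w [] ->; [left | right; left | right; right; left].
- exact: conA.
- by move=> u Au; exists u.
- by move=> u v Au Av /eqP; rewrite fI // => /eqP.
- by move=> w [u Au fu]; exists u.
- by move=> u v Au Av; apply: asbool_eq_equiv; rewrite -/(a _ _) -fA.
by exists g; [exact: automorphism_aut | rewrite !gf].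
Qed.

Let sep : exists C, sepcut e C.
Proof.
case: ends => R1 [R2 [[i1 r1] [[i2 r2] neq]]].
apply: (@sepcut_of_rays _ e (uadjC _) (fun i => if i then R1 else R2)) => //.
  by case; split => // n; apply/adjP.
move=> [R3 [i3 r3] m3]; apply: neq; exists R3; split; last split.
- by split => // n; apply/adjP.
- by move=> N; have [n [m [Nn E]]] := m3 true N; exists n; split => //; exists m.
- by move=> N; have [n [m [Nn E]]] := m3 false N; exists n; split => //; exists m.
Qed.

Let etri : exists x y z, [/\ e x y, e y z & e x z].
Proof. by case: tri => x [y [z [xy [yz xz]]]]; exists x, y, z; split; apply/adjP. Qed.

Lemma homogeneous_iso_T : exists r, isomorphic_to_T arc r.
Proof.
have [t t_gt0 tP] := step_ex irr econn star2 sep etri.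
have [x0 _] := etri.
have cyc x y : exists z, a x y -> [/\ a y z, a z x & forall w, e x w -> e y w -> w = z].
  case xy: (a x y); last by exists x.
  have [z hz] := cyclic_triangle irr asym econn locfin vtrans star2 etri t_gt0 tP xy.
  by exists z.
have nxs x := choice (cyc x); pose nx x y := projT1 (nxs x) y.
have nxP x y : a x y -> [/\ a y (nx x y), a (nx x y) x &
    forall w, e x w -> e y w -> w = nx x y] by exact: (projT2 (nxs x) y).
(* The rank is the common out-degree: one generator for each triangle at a vertex. *)
pose r := ncard (fun y => a x0 y).
have fa x : fin (fun y => a x y) by apply: fin_sub (locfin x) _ => y xy; rewrite /uadj xy.
have rE x : ncard (fun y => a x y) = r.
  have [g [[h gK hK] ga] <-] := vtrans x0 x; apply/esym.
  by apply: (ncard_bij (f := g) (g := h)) => // y; [rewrite ga | rewrite -[a x0 _]ga hK].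
have lab x : exists o : 'I_r -> V, injective o /\ forall y, a x y <-> exists i, o i = y.
  have [L lL] := finE (fa x); have sL : size L = r by rewrite -(rE x) (ncardE lL).
  case: lL => uL PL; exists (fun i => nth x L i); split.
    by move=> i j /eqP; rewrite nth_uniq ?sL // => /eqP/val_inj.
  move=> y; rewrite PL; split; last by case=> i <-; rewrite mem_nth ?sL.
  move=> yL; have ltL : index y L < r by rewrite -sL index_mem.
  by exists (Ordinal ltL); rewrite /= nth_index.
have [o oP] := choice lab.
exists r; have [|||||||||||phi [bphi aphi]] := @coordinates_iso V a r o nx x0 (toward a t x0).
- exact: asym.
- exact: econn.
- by move=> x; case: (oP x).
- by move=> x; case: (oP x).
- by move=> x y /nxP[].
- by move=> x y /nxP[].
- by move=> x y w /nxP[_ _]; apply.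
- by move=> u; exact: toward_irr.
- by move=> u; exact: toward0.
- by move=> v u u'; exact: (toward_uniq irr asym econn locfin vtrans star2 etri t_gt0 tP).
- by move=> v u w; exact: (toward_step irr asym econn locfin vtrans star2 etri t_gt0 tP).
by exists phi; split => // x y; rewrite -aphi; split => /asboolP.
Qed.

End Forward.

Lemma iso_T_homogeneous (V : Type) (arc : V -> V -> Prop) r :
  isomorphic_to_T arc r -> conn_homogeneous arc.
Proof.
move=> [phi [[psi phiK psiK] aphi]] A B f [l Al] cA AB fI _ fE.
case: (lem (exists x, A x)) => [[x0 A0]|nA]; last first.
  exists id; split; first by split => //; exists id.
  by move=> x Ax; case: nA; exists x.
pose A' x := A (psi x); pose f' x := phi (f (psi x)).
have aE u v : arc u v <-> tarc (phi u) (phi v) by rewrite aphi; split => /tarcP.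
have [|||||g [[h gK hK] ga] gf] := @T_homogeneous r A' f' (phi x0).
- exists (map phi l) => x /Al; elim: l {Al} => //= y l IHl [->|/IHl xl].
    by rewrite psiK mem_head.
  by rewrite inE xl orbT.
- by rewrite /A' phiK.
- move=> Q Q0 cl y A'y; rewrite -[y]psiK.
  apply: (upath_ind_on (Q := fun v => Q (phi v)) (cA _ _ A0 A'y)) Q0 => u v Au Av uv.
  apply: cl; rewrite /A' ?phiK //; apply/orP.
  by case: uv => /aE ->; [left | right].
- by move=> x y Ax Ay /(can_inj phiK)/(fI _ _ Ax Ay)/(can_inj psiK).
- move=> x y Ax Ay; rewrite /f'; apply/idP/idP.
    by rewrite -{1}(psiK x) -{1}(psiK y) -!aE => /(fE _ _ Ax Ay).
  by rewrite -aE => /(fE _ _ Ax Ay)/aE; rewrite !psiK.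
exists (psi \o g \o phi); split.
  split; first by exists (psi \o h \o phi) => x /=; rewrite psiK ?gK ?hK phiK.
  by move=> x y; rewrite !aE /= !psiK ga.
by move=> x Ax; rewrite /= gf /f' /A' ?phiK.
Qed.

Theorem theorem7p1 (V : Type) (arc : V -> V -> Prop) :
  is_digraph arc -> connected arc -> locally_finite arc ->
  more_than_one_end arc -> embeds_triangle arc ->
  (conn_homogeneous arc <-> exists r : nat, isomorphic_to_T arc r).
Proof.
move=> dig con loc ends tri; split => [hom|[r]]; last exact: iso_T_homogeneous.
(* Classical logic equips [V] with a decidable equality. *)
exact: (@homogeneous_iso_T {classic V} arc).
Qed.
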